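(* Let $X$ be an uncountable set. Let $E=(E^0,E^1,d,r)$ be the discrete graph in which $E^0$ is the set of all finite subsets of $X$, $E^1=\{(x;v)\mid v\in E^0,\ x\in v\}$, $d((x;v))=v$ and $r((x;v))=v\setminus\{x\}$ (both $E^0$ and $E^1$ carry the discrete topology). Then the $C^*$-algebra $\mathcal{O}(E)$ is prime, but not primitive.
   Context: A topological graph $E=(E^0,E^1,d,r)$ consists of two locally compact Hausdorff spaces $E^0,E^1$, a local homeomorphism $d\colon E^1\to E^0$ and a continuous map $r\colon E^1\to E^0$; a discrete graph is one with $E^0,E^1$ discrete. Put $E^0_{\rm sce}=E^0\setminus\overline{r(E^1)}$, $E^0_{\rm fin}=\{v\in E^0: v$ has a neighborhood $V$ with $r^{-1}(V)$ compact$\}$, $E^0_{\rm rg}=E^0_{\rm fin}\setminus\overline{E^0_{\rm sce}}$ (for a discrete graph, $E^0_{\rm rg}=\{v: 0<|r^{-1}(v)|<\infty\}$). $C_d(E^1)$ is the set of continuous functions $\xi$ on $E^1$ such that $\langle\xi,\xi\rangle(v)=\sum_{e\in d^{-1}(v)}|\xi(e)|^2<\infty$ for all $v$ and $\langle\xi,\xi\rangle\in C_0(E^0)$. It is a Hilbert $C_0(E^0)$-module with $(\xi f)(e)=\xi(e)f(d(e))$, $\langle\xi,\eta\rangle(v)=\sum_{e\in d^{-1}(v)}\overline{\xi(e)}\eta(e)$, and has a left action $(\pi_r(f)\xi)(e)=f(r(e))\xi(e)$ of $C_0(E^0)$; $\pi_r(C_0(E^0_{\rm rg}))\subset\mathcal{K}(C_d(E^1))$.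 A Toeplitz $E$-pair on a $C^*$-algebra $A$ is a pair $T=(T^0,T^1)$ of a $*$-homomorphism $T^0\colon C_0(E^0)\to A$ and a linear map $T^1\colon C_d(E^1)\to A$ with $T^1(\xi)^*T^1(\eta)=T^0(\langle\xi,\eta\rangle)$ and $T^0(f)T^1(\xi)=T^1(\pi_r(f)\xi)$. It is a Cuntz-Krieger $E$-pair if $T^0(f)=\varPhi(\pi_r(f))$ for all $f\in C_0(E^0_{\rm rg})$, where $\varPhi\colon\mathcal{K}(C_d(E^1))\to A$ is the $*$-homomorphism with $\varPhi(\theta_{\xi,\eta})=T^1(\xi)T^1(\eta)^*$. $\mathcal{O}(E)$ is the $C^*$-algebra generated by the universal Cuntz-Krieger $E$-pair $t=(t^0,t^1)$. A $C^*$-algebra is prime if for any two closed two-sided ideals $I_1,I_2$, $I_1\cap I_2=0$ implies $I_1=0$ or $I_2=0$; it is primitive if it has a faithful irreducible representation. *)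

(* Defs.v *)
From HB Require Import structures.
From mathcomp Require Import all_boot all_order all_algebra finmap.
From mathcomp Require Import complex.
From mathcomp Require Import all_classical all_reals all_analysis.
From mathcomp.analysis.showcase Require summability.

Set Implicit Arguments.
Unset Strict Implicit.
Unset Printing Implicit Defensive.

Import Order.TTheory GRing.Theory Num.Theory.
Import numFieldNormedType.Exports.

Local Open Scope classical_set_scope.
Local Open Scope ring_scope.

(* C*-algebras need not be unital, so MathComp's (unital) algebra structures
   cannot carry the product.  Norms take their values in the nonnegative real
   elements of [R[i]]. *)
Record cstarAlgebra (R : realType) := CstarAlgebra {
  cstar_sort :> completeNormedModType R[i];
  cmul : cstar_sort -> cstar_sort -> cstar_sort;
  cadj : cstar_sort -> cstar_sort;
  cmulA : forall a b c, cmul a (cmul b c) = cmul (cmul a b) c;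
  cmul_linearl : forall (z : R[i]) a b c,
    cmul (z *: a + b) c = z *: cmul a c + cmul b c;
  cmul_linearr : forall (z : R[i]) a b c,
    cmul a (z *: b + c) = z *: cmul a b + cmul a c;
  cadjK : forall a, cadj (cadj a) = a;
  cadj_antilinear : forall (z : R[i]) a b,
    cadj (z *: a + b) = z^* *: cadj a + cadj b;
  cadjM : forall a b, cadj (cmul a b) = cmul (cadj b) (cadj a);
  cmul_norm : forall a b, `|cmul a b| <= `|a| * `|b|;
  cstar_identity : forall a, `|cmul (cadj a) a| = `|a| ^+ 2
}.

Section CstarTheory.
Context {R : realType}.
Implicit Types A B : cstarAlgebra R.

Definition star_hom A B (rho : A -> B) : Prop :=
  [/\ forall (z : R[i]) a b, rho (z *: a + b) = z *: rho a + rho b,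
      forall a b, rho (cmul a b) = cmul (rho a) (rho b)
    & forall a, rho (cadj a) = cadj (rho a)].

Definition subspace_set (V : lmodType R[i]) (S : set V) : Prop :=
  S 0 /\ forall (z : R[i]) x y, S x -> S y -> S (z *: x + y).

Definition closed_star_subalgebra A (S : set A) : Prop :=
  [/\ closed S, subspace_set S,
      forall a b, S a -> S b -> S (cmul a b)
    & forall a, S a -> S (cadj a)].

Definition cstar_generated A (G : set A) : Prop :=
  forall S : set A, closed_star_subalgebra S -> G `<=` S -> S = setT.

Definition closed_ideal A (I : set A) : Prop :=
  [/\ closed I, subspace_set I,
      forall a b, I b -> I (cmul a b)
    & forall a b, I a -> I (cmul a b)].

Definition prime_cstar A : Prop :=
  forall I1 I2 : set A, closed_ideal I1 -> closed_ideal I2 ->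
    I1 `&` I2 = [set 0] -> I1 = [set 0] \/ I2 = [set 0].

End CstarTheory.

Record hilbertSpace (R : realType) := HilbertSpace {
  hilbert_sort :> completeNormedModType R[i];
  hdot : hilbert_sort -> hilbert_sort -> R[i];
  hdot_linear : forall (z : R[i]) x y w,
    hdot x (z *: y + w) = z * hdot x y + hdot x w;
  hdot_conj : forall x y, hdot y x = (hdot x y)^*;
  hdot_norm : forall x, hdot x x = `|x| ^+ 2
}.

Section Representations.
Context {R : realType} (A : cstarAlgebra R) (H : hilbertSpace R).

(* *-homomorphisms from [A] to the bounded operators on [H] *)
Definition representation (pi : A -> H -> H) : Prop :=
  [/\ forall a (z : R[i]) x y, pi a (z *: x + y) = z *: pi a x + pi a y,
      forall a, continuous (pi a),
      forall (z : R[i]) a b x, pi (z *: a + b) x = z *: pi a x + pi b x,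
      forall a b x, pi (cmul a b) x = pi a (pi b x)
    & forall a x y, hdot (pi (cadj a) x) y = hdot x (pi a y)].

Definition faithful (pi : A -> H -> H) : Prop :=
  forall a, (forall x, pi a x = 0) -> a = 0.

Definition irreducible (pi : A -> H -> H) : Prop :=
  (exists a x, pi a x != 0) /\
  forall S : set H, closed S -> subspace_set S ->
    (forall a x, S x -> S (pi a x)) -> S = [set 0] \/ S = setT.

End Representations.

Definition primitive_cstar {R : realType} (A : cstarAlgebra R) : Prop :=
  exists (H : hilbertSpace R) (pi : A -> H -> H),
    [/\ representation pi, faithful pi & irreducible pi].

Definition local_homeomorphism (S T : topologicalType) (f : S -> T) : Prop :=
  forall x, exists U : set S,
    [/\ open U, U x, open (f @` U), {within U, continuous f}
      & exists g : T -> S, (forall y, U y -> g (f y) = y) /\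
          {within f @` U, continuous g}].

Record topGraph := TopGraph {
  vertex : topologicalType;
  edge : topologicalType;
  gdom : edge -> vertex;
  grng : edge -> vertex;
  vertex_lc : locally_compact [set: vertex];
  vertex_hausdorff : hausdorff_space vertex;
  edge_lc : locally_compact [set: edge];
  edge_hausdorff : hausdorff_space edge;
  gdom_local_homeo : local_homeomorphism gdom;
  grng_continuous : continuous grng
}.

Section GraphSets.
Variable E : topGraph.

Definition E0sce : set (vertex E) := ~` closure (range (@grng E)).

Definition E0fin : set (vertex E) :=
  [set v | exists V, nbhs v V /\ compact (@grng E @^-1` V)].

Definition E0rg : set (vertex E) := E0fin `\` closure E0sce.

End GraphSets.

(* The usual topology of [R[i]] is carried by its alias [R[i]^o]. *)
Definition C0 {R : realType} (T : topologicalType) : set (T -> R[i]) :=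
  [set f | continuous (f : T -> R[i]^o) /\
           forall eps : R[i], 0 < eps -> compact [set x | eps <= `|f x|]].
Arguments C0 {R T}.

Section Module.
Context {R : realType} (E : topGraph).
Local Notation C := R[i].
Local Notation E0 := (vertex E).
Local Notation E1 := (edge E).

(* [C0 (E0rg E)], extended by zero to all of [E0]. *)
Definition C0rg : set (E0 -> C) :=
  [set f | C0 f /\ forall v, ~ E0rg v -> f v = 0].

(* The fibres of [gdom] may be infinite; sums over them are unconditional, i.e.
   limits along the directed set of finite subsets of the fibre. *)
Definition inner (xi eta : E1 -> C) (v : E0) : C :=
  summability.sum
    (fun e : @gdom E @^-1` [set v] => (xi (val e))^* * eta (val e) : C^o).

Definition fibre_finite (xi : E1 -> C) (v : E0) : Prop :=
  cvg (summability.partial_sum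
    (fun e : @gdom E @^-1` [set v] => `|xi (val e)| ^+ 2 : C^o)
    @ summability.totally).

Definition Cd : set (E1 -> C) :=
  [set xi | [/\ continuous (xi : E1 -> C^o), forall v, fibre_finite xi v
              & C0 (inner xi xi)]].

Definition pi_r (f : E0 -> C) (xi : E1 -> C) : E1 -> C :=
  fun e => f (grng e) * xi e.

(* Operators on [Cd] are maps [operator], of which only the restriction to
   [Cd] is relevant. *)
Definition operator := (E1 -> C) -> (E1 -> C).

Definition theta (xi eta : E1 -> C) : operator :=
  fun zeta e => xi e * inner eta zeta (gdom e).

Definition adjoint_pair (k k' : operator) : Prop :=
  [/\ forall xi, Cd xi -> Cd (k xi), forall xi, Cd xi -> Cd (k' xi)
    & forall xi eta, Cd xi -> Cd eta -> inner (k xi) eta = inner xi (k' eta)].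

(* The norm of [xi] is the square root of the supremum of [inner xi xi]. *)
Definition opnorm_le (k : operator) (c : C) : Prop :=
  forall zeta, Cd zeta -> (forall v, inner zeta zeta v <= 1) ->
    forall v, inner (k zeta) (k zeta) v <= c ^+ 2.

(* The closed linear span of the [theta xi eta] in the adjointable operators;
   scalars are absorbed in [xi]. *)
Definition compact_operators : set operator :=
  [set k | (exists k', adjoint_pair k k') /\
    forall eps : C, 0 < eps -> exists n (xi eta : 'I_n -> E1 -> C),
      (forall i, Cd (xi i) /\ Cd (eta i)) /\
      opnorm_le
        (fun zeta e => k zeta e - \sum_(i < n) theta (xi i) (eta i) zeta e)
        eps].

End Module.

Arguments Cd {R} E.
Arguments C0rg {R} E.
Arguments compact_operators {R} E.
Arguments operator R E : clear implicits.

Section Pairs.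
Context {R : realType} (E : topGraph).
Local Notation C := R[i].
Local Notation E0 := (vertex E).
Local Notation E1 := (edge E).

(* [T0] and [T1] are maps on [C0] and [Cd]; their values elsewhere are
   irrelevant. *)
Record toeplitz_pair (A : cstarAlgebra R)
    (T0 : (E0 -> C) -> A) (T1 : (E1 -> C) -> A) : Prop := ToeplitzPair {
  T0_linear : forall (z : C) f g, C0 f -> C0 g ->
    T0 (fun v => z * f v + g v) = z *: T0 f + T0 g;
  T0_mul : forall f g, C0 f -> C0 g ->
    T0 (fun v => f v * g v) = cmul (T0 f) (T0 g);
  T0_adj : forall f, C0 f -> T0 (fun v => (f v)^*) = cadj (T0 f);
  T1_linear : forall (z : C) xi eta, Cd E xi -> Cd E eta ->
    T1 (fun e => z * xi e + eta e) = z *: T1 xi + T1 eta;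
  T1_inner : forall xi eta, Cd E xi -> Cd E eta ->
    cmul (cadj (T1 xi)) (T1 eta) = T0 (inner xi eta);
  T0_T1 : forall f xi, C0 f -> Cd E xi ->
    cmul (T0 f) (T1 xi) = T1 (pi_r f xi)
}.

(* [Phi] is the *-homomorphism on the compact operators induced by [T1]. *)
Record compact_extension (A : cstarAlgebra R) (T1 : (E1 -> C) -> A)
    (Phi : operator R E -> A) : Prop := CompactExtension {
  Phi_ext : forall k l, compact_operators E k -> compact_operators E l ->
    (forall xi, Cd E xi -> k xi = l xi) -> Phi k = Phi l;
  Phi_linear : forall (z : C) k l,
    compact_operators E k -> compact_operators E l ->
    Phi (fun xi e => z * k xi e + l xi e) = z *: Phi k + Phi l;
  Phi_mul : forall k l, compact_operators E k -> compact_operators E l ->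
    Phi (fun xi => k (l xi)) = cmul (Phi k) (Phi l);
  Phi_adj : forall k k', compact_operators E k -> compact_operators E k' ->
    adjoint_pair k k' -> Phi k' = cadj (Phi k);
  Phi_theta : forall xi eta, Cd E xi -> Cd E eta ->
    Phi (theta xi eta) = cmul (T1 xi) (cadj (T1 eta))
}.

(* For a Toeplitz pair, the induced [Phi] exists and its values on the compact
   operators are unique, so quantifying over it amounts to naming it. *)
Definition cuntz_krieger_pair (A : cstarAlgebra R)
    (T0 : (E0 -> C) -> A) (T1 : (E1 -> C) -> A) : Prop :=
  toeplitz_pair T0 T1 /\
  forall Phi, compact_extension T1 Phi ->
    forall f, C0rg E f -> T0 f = Phi (pi_r f).

(* [A], with the pair [(t0, t1)], is the C*-algebra [O(E)]; this determines it
   up to a unique isomorphism compatible with the pairs. *)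
Record graph_cstar_algebra (A : cstarAlgebra R)
    (t0 : (E0 -> C) -> A) (t1 : (E1 -> C) -> A) : Prop := GraphCstarAlgebra {
  graph_algebra_pair : cuntz_krieger_pair t0 t1;
  graph_algebra_generated : cstar_generated (t0 @` C0 `|` t1 @` Cd E);
  graph_algebra_universal :
    forall (B : cstarAlgebra R) (T0 : (E0 -> C) -> B) (T1 : (E1 -> C) -> B),
      cuntz_krieger_pair T0 T1 ->
      exists rho : A -> B, [/\ star_hom rho,
        forall f, C0 f -> rho (t0 f) = T0 f
      & forall xi, Cd E xi -> rho (t1 xi) = T1 xi]
}.

End Pairs.

Section DiscreteGraph.
Variables (V W : choiceType) (d r : W -> V).
Local Notation DV := (discrete_topology V).
Local Notation DW := (discrete_topology W).

Lemma discrete_locally_compact (T : choiceType) :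
  locally_compact [set: discrete_topology T].
Proof.
move=> x _; exists [set x].
  exact: (@filterS _ (nbhs x) _ _ _ (fun y yx _ => yx)
    (@discrete_set1 (discrete_topology T) x)).
by split; [exact: compact_set1 | exact: discrete_closed].
Qed.

Lemma discrete_hausdorff (T : choiceType) :
  hausdorff_space (discrete_topology T).
Proof.
move=> x y /(_ _ _ (discrete_set1 _) (discrete_set1 _)).
by case=> z [/= -> ->].
Qed.

Lemma discrete_continuous (T : choiceType) (U : topologicalType)
  (f : discrete_topology T -> U) : continuous f.
Proof.
move=> x A /nbhs_singleton Afx.
by apply: filterS (discrete_set1 _) => _ ->.
Qed.

Lemma discrete_local_homeo : local_homeomorphism (d : DW -> DV).
Proof.
move=> x; exists [set x]; split => //; try exact: discrete_open.
  by apply: continuous_subspaceT; exact: discrete_continuous.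
exists (fun=> x); split; first by move=> y ->.
by apply: continuous_subspaceT; exact: discrete_continuous.
Qed.

Definition discreteGraph : topGraph :=
  @TopGraph DV DW d r
    (@discrete_locally_compact V) (@discrete_hausdorff V)
    (@discrete_locally_compact W) (@discrete_hausdorff W)
    discrete_local_homeo (@discrete_continuous W DV r).

End DiscreteGraph.

(* The edge [(x; v)] is the pair [(x, v)] with [x \in v]. *)
Definition finsetEdge (X : choiceType) : choiceType :=
  {p : X * {fset X} | p.1 \in p.2}.

Definition finsetGraph (X : choiceType) : topGraph :=
  @discreteGraph {fset X} (finsetEdge X)
    (fun e => (val e).2) (fun e => ((val e).2 `\ (val e).1)%fset).

(* Main.v *)
From HB Require Import structures.
Require Import Defs.
From mathcomp Require Import all_boot all_order all_algebra finmap.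
From mathcomp Require Import complex.
From mathcomp Require Import all_classical all_reals all_analysis.
From mathcomp.analysis.showcase Require summability.
From mathcomp Require Import ring lra.

Set Implicit Arguments.
Unset Strict Implicit.
Unset Printing Implicit Defensive.

Import Order.TTheory GRing.Theory Num.Theory.
Import numFieldNormedType.Exports.

Local Open Scope classical_set_scope.
Local Open Scope ring_scope.

(** Since [X] is infinite, every vertex receives infinitely many edges, so
[E0rg] is empty and O(E) is the universal Toeplitz algebra. Write [p_v] for
[t0 (delta_v)] and [S_mu] for the partial isometry of a path [mu]; the elements
[S_mu S_nu^*] span a dense *-subalgebra which is an increasing union of
finite-dimensional ones.

Every nonzero closed ideal [I] contains some [p_v]: a selfadjoint element [h] of
the dense subalgebra close to some [a^* a] in [I] has an eigenvector there for
an eigenvalue [z] with [|z| > |h| / 2], and right multiplication by a path of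
minimal source followed by an edge removing a fresh element turns it into [q]
with [q^* q] and [q^* h q] multiples of one [p_v]. As [p_v] in [I] implies [p_w] in
[I] for all [w] containing [v], and as all [p_v] are nonzero (they act on the
paths with source [v]), two nonzero ideals share some [p_(v1 U v2)].

If a faithful representation had a cyclic vector [xi], then for every [x] some
path [mu] whose source contains [x] would satisfy [S_mu^* xi <> 0]. For each length
the projections [S_mu S_mu^*] are orthogonal, so by Bessel's inequality there
are only countably many such [mu], and [X] would be a countable union of finite
sets. *)

(** * C*-algebras *)

(** A dense subalgebra need not meet [I] outside 0, so nothing can be computed inside [I] directly.
    An approximant [h] is compressed instead, until an estimate [|p_v - b| < 1] with [b] in [I]
    decides that the projection [p_v] lies in [I]. The compression acts on the right while [h] acts
    on the left, so it keeps the eigenvalue. The eigenvector itself is obtained from the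
    C*-identity: [h] has an annihilating polynomial, and if every root that owns an eigenvector were
    small, the powers of [h] would grow too slowly for [|h^(2^n)| = |h|^(2^n)].

    Boundedness has the same source. A representation is assumed continuous one operator at a time
    and a Toeplitz pair is purely algebraic, so norm bounds in the algebra variable have to be
    proved; this is where the factors 2 come from.

    The algebra is given by its universal property only, so [p_v <> 0] requires a concrete pair. The
    paths with a fixed source are finite in number and closed under extension at the range, so a
    matrix algebra can carry it. *)

Section RealNorm.
Context {R : realType} (V : normedModType R[i]).
Implicit Types x y : V.

(* The norm of a normed module over [R[i]] is an element of [R[i]]. *)
Definition nrm x : R := complex.Re `|x|.

Lemma nrmE x : `|x| = ((nrm x)%:C)%C.
Proof. by rewrite RRe_real // ger0_real. Qed.

Lemma nrm_le x (c : R) : (nrm x <= c) = (`|x| <= c%:C%C).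
Proof. by rewrite nrmE lecR. Qed.

Lemma nrm_lt x (c : R) : (nrm x < c) = (`|x| < c%:C%C).
Proof. by rewrite nrmE ltcR. Qed.

Lemma nrm_ge0 x : 0 <= nrm x.
Proof. by rewrite -(@lecR R) -nrmE; exact: normr_ge0. Qed.

Lemma nrm0 : nrm (0 : V) = 0.
Proof. by rewrite /nrm normr0. Qed.

Lemma nrm_eq0 x : (nrm x == 0) = (x == 0).
Proof. by rewrite -(normr_eq0 x) nrmE -(inj_eq (@complexI R)). Qed.

Lemma nrm_gt0 x : (0 < nrm x) = (x != 0).
Proof. by rewrite lt0r nrm_eq0 nrm_ge0 andbT. Qed.

Lemma nrmD x y : nrm (x + y) <= nrm x + nrm y.
Proof. by rewrite nrm_le rmorphD /= -!nrmE ler_normD. Qed.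

Lemma nrmN x : nrm (- x) = nrm x.
Proof. by rewrite /nrm normrN. Qed.

Lemma nrmB x y : nrm (x - y) = nrm (y - x).
Proof. by rewrite -nrmN opprB. Qed.

Lemma nrm_triB x y : nrm x <= nrm (x - y) + nrm y.
Proof. by rewrite -{1}(subrK y x) nrmD. Qed.

End RealNorm.

Section NormC.
Context {R : realType}.

Definition nrmc (z : R[i]) : R := complex.Re `|z|.

Lemma nrmcE z : `|z| = ((nrmc z)%:C)%C.
Proof. by rewrite RRe_real // ger0_real. Qed.

Lemma nrmcM z t : nrmc (z * t) = nrmc z * nrmc t.
Proof. by apply: (@complexI R); rewrite rmorphM /= -!nrmcE normrM. Qed.

Lemma nrmc_ge0 z : 0 <= nrmc z.
Proof. by rewrite -(@lecR R) -nrmcE; exact: normr_ge0. Qed.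

Lemma nrmc_gt0 z : (0 < nrmc z) = (z != 0).
Proof. by rewrite -ltcR -nrmcE normr_gt0. Qed.

Lemma nrmcV z : nrmc z^-1 = (nrmc z)^-1.
Proof. by apply: (@complexI R); rewrite fmorphV /= -!nrmcE normfV. Qed.

Lemma nrmcR (c : R) : nrmc (c%:C)%C = `|c|.
Proof. by rewrite /nrmc normc_def /= expr0n addr0 sqrtr_sqr. Qed.

Lemma nrmcJ (z : R[i]) : nrmc z^* = nrmc z.
Proof. by rewrite /nrmc norm_conjC. Qed.

Lemma nrmZ (V : normedModType R[i]) z (x : V) : nrm (z *: x) = nrmc z * nrm x.
Proof.
by apply: (@complexI R); rewrite rmorphM /= -nrmE -nrmcE -nrmE normrZ.
Qed.

End NormC.

Section LinearSpan.
Context {K : pzRingType} {V : lmodType K}.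
Implicit Types (G : V -> Prop).

Inductive lin G : V -> Prop :=
  | lin0 : lin G 0
  | linS z g a : G g -> lin G a -> lin G (z *: g + a).

Lemma lin_gen G g : G g -> lin G g.
Proof. by move=> Gg; rewrite -[g]scale1r -[_ *: _]addr0; apply/linS/lin0. Qed.

Lemma linD G a b : lin G a -> lin G b -> lin G (a + b).
Proof.
move=> la lb; elim: la => [|z g c Gg _ IH]; first by rewrite add0r.
by rewrite -addrA; apply: linS.
Qed.

Lemma linZ G z a : lin G a -> lin G (z *: a).
Proof.
elim=> [|t g c Gg _ IH]; first by rewrite scaler0; apply: lin0.
by rewrite scalerDr scalerA; apply: linS.
Qed.

Lemma lin_least G (P : V -> Prop) : P 0 ->
  (forall z a b, P a -> P b -> P (z *: a + b)) -> (forall g, G g -> P g) ->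
  forall a, lin G a -> P a.
Proof.
by move=> P0 PS PG a; elim=> [//|z g b Gg _ Pb]; apply: PS => //; apply: PG.
Qed.

Lemma lin_linear G z a b : lin G a -> lin G b -> lin G (z *: a + b).
Proof. by move=> la lb; apply: linD => //; apply: linZ. Qed.

Lemma lin_mono G G' a : (forall g, G g -> lin G' g) -> lin G a -> lin G' a.
Proof. by move=> GG'; apply: lin_least => //; [exact: lin0|exact: lin_linear]. Qed.

End LinearSpan.

(** * Annihilating polynomials on a finite-dimensional orbit *)

Section Annihilator.
Context {F : closedFieldType} {V : lmodType F} (f : V -> V).
Hypothesis flin : forall z a b, f (z *: a + b) = z *: f a + f b.

Definition poly_act (p : {poly F}) x := \sum_(k < size p) p`_k *: iter k f x.

Let fD a b : f (a + b) = f a + f b.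
Proof. by have := flin 1 a b; rewrite !scale1r. Qed.

Let f0 : f 0 = 0.
Proof. by apply: (@addrI _ (f 0)); rewrite -fD !addr0. Qed.

Let fZ z a : f (z *: a) = z *: f a.
Proof. by have := flin z a 0; rewrite f0 !addr0. Qed.

Lemma poly_act_widen n (p : {poly F}) (x : V) : (size p <= n)%N ->
  poly_act p x = \sum_(k < n) p`_k *: iter k f x.
Proof.
move=> le; rewrite /poly_act (big_ord_widen n (fun k => p`_k *: iter k f x)) //.
rewrite big_mkcond /=; apply: eq_bigr => i _; case: ltnP => // h.
by rewrite nth_default // scale0r.
Qed.

Lemma poly_act_XsubC (p : {poly F}) z (x : V) : poly_act (p * ('X - z%:P)) x
  = poly_act p (f x - z *: x).
Proof.
set n := (size p).+1.
have sz : (size (p * ('X - z%:P))%R <= n)%N.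
  have [->|p0] := eqVneq p 0; first by rewrite mul0r size_poly0.
  by rewrite size_Mmonic ?monicXsubC// size_XsubC addn2.
rewrite (poly_act_widen _ sz) (@poly_act_widen n); last exact: leqnSn.
have iterB k : iter k f (f x - z *: x) = iter k.+1 f x - z *: iter k f x.
  by elim: k => // k IH; rewrite iterS IH -scaleN1r addrC flin fZ scaleN1r addrC.
under [RHS]eq_bigr do rewrite iterB scalerBr.
rewrite sumrB [X in _ = X - _]big_ord_recr /= nth_default // scale0r addr0.
under eq_bigr do rewrite mulrBr coefB coefMX coefMC scalerBl.
rewrite sumrB big_ord_recl /= scale0r add0r; congr (_ - _).
by apply: eq_bigr => i _; rewrite scalerA.
Qed.

Lemma poly_act_roots (rs : seq F) c x :
  poly_act (c *: \prod_(z <- rs) ('X - z%:P)) x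
  = c *: foldr (fun z y => f y - z *: y) x rs.
Proof.
elim/last_ind: rs x => [|rs z IH] x.
  rewrite big_nil /= alg_polyC (@poly_act_widen 1) ?size_polyC_leq1//.
  by rewrite big_ord1 coefC.
by rewrite -cats1 big_cat big_seq1 scalerAl poly_act_XsubC IH /= foldr_cat.
Qed.

(** The [n + 1] vectors [x, f x, ..., f^n x] lie in the span of [n] vectors, so a nonzero polynomial
    in [f] kills [x]. It splits over a closed field, and only its roots are kept, one factor at a
    time. *)
Lemma annihilating_roots (gs : seq V) x :
  (forall k, lin (fun g => g \in gs) (iter k f x)) ->
  exists rs, foldr (fun z y => f y - z *: y) x rs = 0.
Proof.
move=> hx; set n := size gs.
have coords v : lin (fun g => g \in gs) v ->
    exists c : 'rV[F]_n, v = \sum_(j < n) c 0 j *: gs`_j.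
  elim=> [|z g a gg _ [c ->]].
    by exists 0; rewrite big1 // => j _; rewrite mxE scale0r.
  have /(nthP 0)[j jn <-] := gg.
  exists (z *: delta_mx 0 (Ordinal jn) + c).
  under [RHS]eq_bigr do rewrite !mxE scalerDl.
  rewrite big_split /=; congr (_ + _).
  rewrite (bigD1 (Ordinal jn)) //= !eqxx mulr1 big1 ?addr0 // => i /negPf ni.
  by rewrite ni mulr0 scale0r.
have [c cE] : exists c : nat -> 'rV[F]_n,
    forall k, iter k f x = \sum_(j < n) (c k) 0 j *: gs`_j.
  have /choice[c cE] := fun k => coords _ (hx k).
  by exists c.
pose M : 'M[F]_(n.+1, n) := \matrix_(k, j) c k 0 j.
have kM : kermx M != 0.
  rewrite -mxrank_eq0 mxrank_ker subn_eq0 -ltnNge ltnS; exact: rank_leq_col.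
have [i /eqP ri] : exists i, row i (kermx M) != 0.
  apply/existsP; apply: contraNT kM; rewrite negb_exists => /forallP h.
  by apply/eqP/row_matrixP => i; rewrite row0; apply/eqP; move: (h i); rewrite negbK.
set u := row i (kermx M) in ri.
have uM : u *m M = 0 by rewrite /u -row_mul mulmx_ker row0.
pose p := rVpoly u.
have p0 : p != 0 by apply: contra_not_neq ri => p0; rewrite -[u]rVpolyK -/p p0 linear0.
have act0 : poly_act p x = 0.
  rewrite (@poly_act_widen n.+1) ?size_poly//.
  under eq_bigr do rewrite coef_rVpoly_ord cE scaler_sumr.
  rewrite exchange_big /= big1 // => j _.
  under eq_bigr do rewrite scalerA.
  rewrite -scaler_suml; have /matrixP/(_ 0 j) := uM; rewrite !mxE => sE.
  under eq_bigr => k _ do [have -> : c k 0 j = M k j by rewrite mxE].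
  by rewrite sE scale0r.
have [rs prs] := closed_field_poly_normal p.
exists rs; move: act0; rewrite prs poly_act_roots => /eqP.
by rewrite scaler_eq0 lead_coef_eq0 (negPf p0) => /eqP.
Qed.

End Annihilator.

Lemma bernoulli (R : realDomainType) (t : R) n : 0 <= t -> 1 + t *+ n <= (1 + t) ^+ n.
Proof.
move=> t0; elim: n => [|n IH]; first by rewrite mulr0n addr0.
rewrite exprS (le_trans _ (ler_wpM2l _ IH)) ?addr_ge0//.
rewrite mulrSr mulrDl mul1r mulrDr mulr1.
have : 0 <= t * (t *+ n) by rewrite mulr_ge0// mulrn_wge0.
lra.
Qed.

Section CstarBasics.
Context {R : realType} {A : cstarAlgebra R}.
Implicit Types (a b c : A) (z : R[i]).

HB.instance Definition _ a := GRing.isLinear.Build R[i] A A _ (cmul a)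
  (fun z => cmul_linearr z a).

Definition cmulr b a := cmul a b.
HB.instance Definition _ b := GRing.isLinear.Build R[i] A A _ (cmulr b)
  (fun z a c => cmul_linearl z a c b).

Lemma cmulDr a b c : cmul a (b + c) = cmul a b + cmul a c.
Proof. exact: linearD. Qed.
Lemma cmulBr a b c : cmul a (b - c) = cmul a b - cmul a c.
Proof. exact: linearB. Qed.
Lemma cmulZr z a b : cmul a (z *: b) = z *: cmul a b.
Proof. exact: linearZ. Qed.
Lemma cmul0r a : cmul a 0 = 0.
Proof. exact: linear0. Qed.
Lemma cmulDl a b c : cmul (b + c) a = cmul b a + cmul c a.
Proof. exact: (linearD (cmulr a)). Qed.
Lemma cmulBl a b c : cmul (b - c) a = cmul b a - cmul c a.
Proof. exact: (linearB (cmulr a)). Qed.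
Lemma cmul0l a : cmul 0 a = 0.
Proof. exact: (linear0 (cmulr a)). Qed.
Lemma cmulZl z a b : cmul (z *: b) a = z *: cmul b a.
Proof. by have := cmul_linearl z b 0 a; rewrite cmul0l !addr0. Qed.

Lemma cmul_suml (I : Type) (r : seq I) (P : pred I) (f : I -> A) b :
  cmul (\sum_(i <- r | P i) f i) b = \sum_(i <- r | P i) cmul (f i) b.
Proof. exact: (linear_sum (cmulr b)). Qed.
Lemma cmul_sumr (I : Type) (r : seq I) (P : pred I) (f : I -> A) a :
  cmul a (\sum_(i <- r | P i) f i) = \sum_(i <- r | P i) cmul a (f i).
Proof. exact: linear_sum. Qed.

Lemma cadjD a b : cadj (a + b) = cadj a + cadj b.
Proof. by have := cadj_antilinear 1 a b; rewrite rmorph1 !scale1r. Qed.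
Lemma cadj0 : cadj (0 : A) = 0.
Proof. by apply: (@addrI _ (cadj 0)); rewrite -cadjD !addr0. Qed.
Lemma cadjZ z a : cadj (z *: a) = z^* *: cadj a.
Proof. by have := cadj_antilinear z a 0; rewrite cadj0 !addr0. Qed.
Lemma cadjN a : cadj (- a) = - cadj a.
Proof. by rewrite -scaleN1r cadjZ rmorphN1 scaleN1r. Qed.
Lemma cadjB a b : cadj (a - b) = cadj a - cadj b.
Proof. by rewrite cadjD cadjN. Qed.

Lemma nrm_cmul a b : nrm (cmul a b) <= nrm a * nrm b.
Proof. by rewrite nrm_le rmorphM /= -!nrmE cmul_norm. Qed.

Lemma nrm_adj_mul a : nrm (cmul (cadj a) a) = nrm a ^+ 2.
Proof. by apply: (@complexI R); rewrite rmorphXn /= -!nrmE cstar_identity. Qed.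

Lemma nrm_adj a : nrm (cadj a) = nrm a.
Proof.
have le b : nrm b <= nrm (cadj b).
  have [->|b0] := eqVneq b 0; first by rewrite nrm0 nrm_ge0.
  have bp : 0 < nrm b by rewrite nrm_gt0.
  by rewrite -(ler_pM2r bp) -expr2 -nrm_adj_mul nrm_cmul.
by apply/eqP; rewrite eq_le le andbT -{2}(cadjK a) le.
Qed.

Lemma cadj_mul_eq0 a : cmul (cadj a) a = 0 -> a = 0.
Proof.
move=> h; apply/eqP; by rewrite -nrm_eq0 -sqrf_eq0 -nrm_adj_mul h nrm0.
Qed.

End CstarBasics.

(** * Large eigenvalues of selfadjoint elements *)

Section Eigenvector.
Context {R : realType} {A : cstarAlgebra R} (h : A) (K : A -> Prop).
Hypothesis K_linear : forall z a b, K a -> K b -> K (z *: a + b).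
Hypothesis K_mul : forall a, K a -> K (cmul h a).

(* Induction on the roots [rs]: dividing by [h - z] either loses nothing or
   exhibits an eigenvector for [z], in which case [|z| <= rho]. *)
Lemma power_growth (rho rho' : R) (rs : seq R[i]) (x : A) :
  0 <= rho -> rho < rho' ->
  (forall z u, K u -> u <> 0 -> cmul h u = z *: u -> nrmc z <= rho) ->
  K x -> foldr (fun z y => cmul h y - z *: y) x rs = 0 ->
  exists2 C, 0 <= C & forall N, nrm (iter N (cmul h) x) <= C * rho' ^+ N.
Proof.
move=> rho0 lt_rho noeig; have rho'0 : 0 <= rho' by lra.
have Kfold y l : K y -> K (foldr (fun z y => cmul h y - z *: y) y l).
  by move=> Ky; elim: l => //= z l IH; rewrite addrC -scaleNr; apply/K_linear/K_mul.
elim: rs x => [|z rs IH] x Kx /= eq0.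
  exists 0 => // N; rewrite eq0 mul0r.
  by elim: N => [|N IHN]; rewrite ?nrm0//= (_ : iter _ _ _ = 0) ?cmul0r ?nrm0//;
     apply/eqP; rewrite -nrm_eq0 eq_le IHN nrm_ge0.
set w := foldr _ x rs in eq0.
have [w0|w0] := eqVneq w 0; first exact: IH.
have z_le : nrmc z <= rho.
  apply: (noeig _ w) => //; [exact: Kfold|exact/eqP|].
  by apply/eqP; rewrite -subr_eq0 eq0.
pose x' := cmul h x - z *: x.
have Kx' : K x' by have := Kfold x [:: z] Kx.
(* The factors commute: the factor of [z], outermost in the hypothesis, moves innermost, and the
   induction hypothesis applies to [x']. *)
have fold_comm l : foldr (fun z y => cmul h y - z *: y) x' l
    = cmul h (foldr (fun z y => cmul h y - z *: y) x l)
      - z *: foldr (fun z y => cmul h y - z *: y) x l.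
  elim: l => //= t l ->; rewrite !cmulBr !cmulZr !scalerBr !scalerA (mulrC t z).
  by rewrite !opprB addrACA [RHS]addrACA (addrC (- (z *: _))).
have [|C C0 Cle] := IH x' Kx'; first by rewrite fold_comm eq0.
have dp : 0 < rho' - rho by lra.
(* The summand [nrm x] starts the recursion. The other gives [C + rho * C' <= rho' * C'], which
   closes it, as [h^(N+1) x = h^N x' + z h^N x]. *)
pose C' := nrm x + C / (rho' - rho).
have C'0 : 0 <= C' by rewrite addr_ge0 ?nrm_ge0// divr_ge0 // ltW.
exists C' => //; elim=> [|N IHN].
  by rewrite expr0 mulr1 /= lerDl divr_ge0 // ltW.
have -> : iter N.+1 (cmul h) x = iter N (cmul h) x' + z *: iter N (cmul h) x.
  elim: N {IHN} => [|N IHN]; first by rewrite /= subrK.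
  rewrite [LHS]iterS {1}IHN cmulDr cmulZr; congr (_ + _).
rewrite (le_trans (nrmD _ _)) // nrmZ.
have h1 := Cle N.
have h2 : nrmc z * nrm (iter N (cmul h) x) <= rho * (C' * rho' ^+ N).
  by rewrite ler_pM ?nrmc_ge0 ?nrm_ge0.
have h3 : C <= C' * (rho' - rho).
  by rewrite mulrDl divfK ?gt_eqF// lerDr mulr_ge0 ?nrm_ge0// ltW.
have h4 : C * rho' ^+ N <= C' * (rho' - rho) * rho' ^+ N.
  by rewrite ler_wpM2r // exprn_ge0.
rewrite exprS; apply: (le_trans (lerD h1 h2)).
rewrite -[leRHS](subrK (rho * (C' * rho' ^+ N))) lerD2r (le_trans h4) //.
by rewrite le_eqVlt; apply/orP; left; apply/eqP; ring.
Qed.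

Hypothesis h_sa : cadj h = h.

(** [hp N] is the power [h^(N + 1)], since there is no unit to start from; hence the exponents
    [(2 ^ n).-1] below. Squaring doubles the exponent, and the C*-identity squares the norm. *)
Let hp N := iter N (cmul h) h.

Let hpD M N : cmul (hp M) (hp N) = hp (M + N).+1.
Proof. by elim: M => [//|M IH]; rewrite addSn [in RHS]/hp iterS -/(hp _) -IH cmulA. Qed.

Let hp_adj N : cadj (hp N) = hp N.
Proof.
elim: N => [//|N IH]; rewrite /hp iterS cadjM -/(hp N) IH h_sa.
by have := hpD N 0; rewrite addn0.
Qed.

Lemma selfadjoint_power_norm n : nrm (hp (2 ^ n).-1) = nrm h ^+ (2 ^ n).
Proof.
elim: n => [//|n IH].
have -> : (2 ^ n.+1).-1 = ((2 ^ n).-1 + (2 ^ n).-1).+1.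
  by rewrite expnS mul2n -addnn; case: (2 ^ n)%N (expn_gt0 2 n) => //= k; rewrite addnS.
by rewrite -hpD -{1}hp_adj nrm_adj_mul IH -exprM expnSr.
Qed.

(** Otherwise [power_growth], with [rho'] midway between [rho] and [nrm h], bounds [|h|^(2^n)] by
    [C * rho'^(2^n - 1)] for all [n], whereas [(|h| / rho')^(2^n)] is unbounded. The predicate [K]
    records where the eigenvector lives. *)
Lemma selfadjoint_eigenvector (gs : seq A) (rho : R) :
  (forall k, lin (fun g => g \in gs) (iter k (cmul h) h)) ->
  K h -> 0 <= rho -> rho < nrm h ->
  exists z u, [/\ K u, u <> 0, cmul h u = z *: u & rho < nrmc z].
Proof.
move=> fin Kh rho0 lt_rho; apply: contrapT => noeig.
have [rs rsE] := annihilating_roots (fun z a b => cmul_linearr z h a b) fin.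
pose rho' := (rho + nrm h) / 2.
have lt1 : rho < rho' by rewrite /rho'; lra.
have lt2 : rho' < nrm h by rewrite /rho'; lra.
have [|C C0 Cle] := @power_growth rho rho' rs h rho0 lt1 _ Kh rsE.
  move=> z u Ku u0 hu; rewrite leNgt; apply/negP => lt; apply: noeig.
  by exists z, u.
have rp : 0 < rho' by lra.
pose t := nrm h / rho' - 1.
have t0 : 0 < t by rewrite subr_gt0 ltr_pdivlMr // mul1r.
have [n nP] : exists n, C / rho' < t * n%:R.
  exists (Num.bound (C / rho' / t)); rewrite (mulrC t) -ltr_pdivrMr //.
  have C1 : 0 <= C / rho' / t := divr_ge0 (divr_ge0 C0 (ltW rp)) (ltW t0).
  exact: archi_boundP C1.
have := Cle (2 ^ n).-1; rewrite -/(hp _) selfadjoint_power_norm => le1.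
have le2 : (1 + t) ^+ (2 ^ n) <= C / rho'.
  rewrite /t addrC subrK exprMn exprVn ler_pdivrMr ?exprn_gt0 //.
  have e : (0 < 2 ^ n)%N by rewrite expn_gt0.
  by rewrite -[X in rho' ^+ X](prednK e) exprS mulrA divfK ?gt_eqF.
have le3 := le_trans (bernoulli (2 ^ n) (ltW t0)) le2.
have le4 : t *+ n <= t *+ (2 ^ n) by rewrite -!(mulr_natr t) ler_pM2l // ler_nat ltnW // ltn_expl.
rewrite -mulr_natr in le4; lra.
Qed.

End Eigenvector.

(** * Paths in the graph of finite subsets *)

(* The relations between [p v = t0 (delta_v)] and [s x v = t1 (delta_(x; v))]
   for a Toeplitz pair; [s x v] is zero when [x] is not in [v]. *)
Record finset_family {R : realType} {A : cstarAlgebra R} {X : choiceType}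
    (p : {fset X} -> A) (s : X -> {fset X} -> A) : Prop := FinsetFamily {
  family_adj : forall v, cadj (p v) = p v;
  family_proj : forall v w, cmul (p v) (p w) = if v == w then p v else 0;
  family_out : forall x (w : {fset X}), x \notin w -> s x w = 0;
  family_orth : forall x y (w v : {fset X}), x \in w ->
    cmul (cadj (s x w)) (s y v) = if (x == y) && (w == v) then p w else 0;
  family_rng : forall v x w,
    cmul (p v) (s x w) = if v == (w `\ x)%fset then s x w else 0
}.

Section Paths.
Context {R : realType} {A : cstarAlgebra R} {X : choiceType}.
Variables (p : {fset X} -> A) (s : X -> {fset X} -> A).
Hypothesis F : finset_family p s.
Implicit Types (v w : {fset X}) (k l m : seq X).

(** A Toeplitz pair has no axiom for the right action; this relation comes from the C*-identity, as
    [a^* a = 0] for the difference [a] of the two sides. *)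
Lemma family_dom x w v :
  cmul (s x w) (p v) = if w == v then s x w else 0.
Proof.
have [xw|xw] := boolP (x \in w); last by rewrite (family_out F) // cmul0l if_same.
have so : cmul (cadj (s x w)) (s x w) = p w by rewrite (family_orth F) // !eqxx.
case: eqVneq => [<-|wv].
  apply/eqP; rewrite -subr_eq0; apply/eqP/cadj_mul_eq0.
  rewrite cadjB cadjM (family_adj F) cmulBl !cmulBr -!cmulA !(cmulA (cadj _)).
  have pw : cmul (p w) (p w) = p w by rewrite (family_proj F) eqxx.
  by rewrite !so !pw !subrr.
apply: cadj_mul_eq0; rewrite cadjM (family_adj F) -cmulA (cmulA (cadj _)) so.
by rewrite (family_proj F) (negPf wv) cmul0r.
Qed.

(* A path is given by its source [w] and the list of the elements of [w] that
   its edges remove, the edge leaving [w] being first. *)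
Fixpoint pth l w : A :=
  if l is x :: l' then cmul (pth l' (w `\ x)%fset) (s x w) else p w.

Fixpoint rng w l : {fset X} := if l is x :: l' then rng (w `\ x)%fset l' else w.

Fixpoint ok l w : bool :=
  if l is x :: l' then (x \in w) && ok l' (w `\ x)%fset else true.

(** Lists that are not paths give 0, so generators can be indexed by all lists. *)
Lemma pth_out l w : ~~ ok l w -> pth l w = 0.
Proof.
elim: l w => [//|x l IH] w /=; rewrite negb_and => /orP[xw|/IH ->].
  by rewrite (family_out F) // cmul0r.
by rewrite cmul0l.
Qed.

Lemma ok_card l w : ok l w -> (#|` rng w l| + size l)%N = #|` w|.
Proof.
elim: l w => [|x l IH] w /=; first by rewrite addn0.
by case/andP=> xw /IH e; rewrite addnS e (cardfsD1 x w) xw.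
Qed.

Lemma rng_cat w k l : rng w (k ++ l) = rng (rng w k) l.
Proof. by elim: k w => //= x k IH w. Qed.

Lemma pth_rng v l w : cmul (p v) (pth l w) = if v == rng w l then pth l w else 0.
Proof.
elim: l w => [|x l IH] w /=.
  by rewrite (family_proj F); case: eqVneq => [->|].
by rewrite cmulA IH; case: eqP; rewrite ?cmul0l.
Qed.

Lemma pth_dom l w v : cmul (pth l w) (p v) = if w == v then pth l w else 0.
Proof.
case: l => [|x l] /=; first by rewrite (family_proj F).
by rewrite -cmulA family_dom; case: eqP; rewrite ?cmul0r.
Qed.

Lemma pth_orth l m w v : size l = size m ->
  cmul (cadj (pth l w)) (pth m v)
  = if [&& l == m, w == v & ok l w] then p w else 0.
Proof.
elim: l m w v => [|x l IH] [|y m] //= w v; last first.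
  case=> sz; rewrite cadjM -cmulA (cmulA (cadj (pth _ _))) IH // andbA.
  have [xw|xw] := boolP (x \in w); last first.
    by rewrite (family_out F) // cadj0 cmul0l /= !andbF.
  rewrite eqseq_cons; case: ifP => [/andP[/andP[/eqP -> /eqP e] okl]|nc].
    by rewrite okl (family_rng F) e eqxx (family_orth F) // eqxx !andbT.
  rewrite cmul0l cmul0r; case: ifP => // /and4P[/andP[/eqP exy /eqP elm] /eqP ewv _ okl].
  by rewrite -exy -elm -ewv !eqxx okl in nc.
by move=> _; rewrite (family_adj F) (family_proj F) andbT.
Qed.

Lemma pth_cat k m w : pth (k ++ m) w = cmul (pth m (rng w k)) (pth k w).
Proof.
elim: k w => [|x k IH] w /=; first by rewrite pth_dom eqxx.
by rewrite IH cmulA.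
Qed.

(** The last [size l] edges of the longer path are compared with [l] by [pth_orth]. If they agree
    they cancel, and the initial segment [k] of [m] remains. *)
Lemma pth_adj_mul l m w v : (size l <= size m)%N ->
  cmul (cadj (pth l w)) (pth m v) = 0 \/
  exists k, [/\ m = k ++ l, rng v k = w, ok l w
              & cmul (cadj (pth l w)) (pth m v) = pth k v].
Proof.
move=> le; set n := (size m - size l)%N.
rewrite -(cat_take_drop n m) pth_cat cmulA pth_orth; last first.
  by rewrite size_drop subKn.
case: ifP => [/and3P[/eqP e1 /eqP e2 okl]|]; last by rewrite cmul0l; left.
by right; exists (take n m); rewrite -e1 e2 pth_rng eqxx -e2.
Qed.

Definition gen l w m := cmul (pth l w) (cadj (pth m w)).

Definition gens (W : {fset X} -> Prop) : A -> Prop :=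
  fun a => exists l w m, W w /\ a = gen l w m.

Lemma gen_adj l w m : cadj (gen l w m) = gen m w l.
Proof. by rewrite /gen cadjM cadjK. Qed.

(* If the product is nonzero, one of the two inner paths extends the other, so
   no new source appears. *)
Lemma gens_mul W a b : gens W a -> gens W b -> lin (gens W) (cmul a b).
Proof.
case=> l [w [m [Ww ->]]] [l' [w' [m' [Ww' ->]]]]; rewrite /gen -cmulA.
rewrite (cmulA (cadj _)).
case: (leqP (size m) (size l')) => sz.
  have [->|[k [ek er _ ->]]] := pth_adj_mul w w' sz.
    by rewrite cmul0l cmul0r; exact: lin0.
  rewrite -er cmulA -pth_cat; apply: lin_gen.
  by exists (k ++ l), w', m'.
have -> : cmul (cadj (pth m w)) (pth l' w') = cadj (cmul (cadj (pth l' w')) (pth m w)).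
  by rewrite cadjM cadjK.
have [->|[k [ek er _ ->]]] := pth_adj_mul w' w (ltnW sz).
  by rewrite cadj0 cmul0l cmul0r; exact: lin0.
rewrite -cadjM -er -pth_cat; apply: lin_gen.
by exists l, w, (k ++ m').
Qed.

Lemma lin_gens_mul W a b : lin (gens W) a -> lin (gens W) b -> lin (gens W) (cmul a b).
Proof.
move=> la lb; elim: la => [|z g c gg _ IH]; first by rewrite cmul0l; exact: lin0.
rewrite cmul_linearl; apply: lin_linear => //.
elim: lb => [|t g' c' gg' _ IH']; first by rewrite cmul0r; exact: lin0.
by rewrite cmul_linearr; apply: lin_linear => //; exact: gens_mul.
Qed.

Lemma lin_gens_adj W a : lin (gens W) a -> lin (gens W) (cadj a).
Proof.
elim=> [|z g c [l [w [m [Ww ->]]]] _ IH]; first by rewrite cadj0; exact: lin0.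
by rewrite cadj_antilinear gen_adj; apply: linS => //; exists m, w, l.
Qed.

Fixpoint words (r : seq X) n : seq (seq X) :=
  if n is n'.+1 then [::] :: [seq x :: l | x <- r, l <- words r n'] else [:: [::]].

Lemma mem_words r n l : (size l <= n)%N -> all (fun x => x \in r) l -> l \in words r n.
Proof.
elim: n l => [|n IH] [|x l] //= sz /andP[xr lr]; rewrite in_cons /=.
by apply/allpairsP; exists (x, l); split=> //=; apply: IH.
Qed.

Lemma ok_words l w : ok l w -> l \in words (enum_fset w) #|` w|.
Proof.
move=> okl; apply: mem_words; first by rewrite -(ok_card okl) leq_addl.
elim: l w okl => [//|x l IH] w /= /andP[-> /IH] /allP h.
by apply/allP => y /h; rewrite in_fsetD1 => /andP[].
Qed.

(** Each edge of a path removes one element, so a vertex is the source of finitely many paths. As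
    products create no new source, finitely many sources span a finite-dimensional subalgebra. *)
Lemma lin_gens_findim (ws : seq {fset X}) : exists gs : seq A,
  forall a, lin (gens (fun w => w \in ws)) a -> lin (fun g => g \in gs) a.
Proof.
pose wd w := words (enum_fset w) #|` w|.
pose gs := flatten [seq [seq gen l w m | l <- wd w, m <- wd w] | w <- ws].
exists gs => a; apply: lin_mono => g [l [w [m [ww ->]]]].
have [okl|/pth_out e] := boolP (ok l w); last by rewrite /gen e cmul0l; exact: lin0.
have [okm|/pth_out e] := boolP (ok m w); last by rewrite /gen e cadj0 cmul0r; exact: lin0.
apply: lin_gen; apply/flattenP; exists [seq gen l w m | l <- wd w, m <- wd w].
  by apply/mapP; exists w.
by apply/allpairsP; exists (l, m); split=> //=; apply: ok_words.
Qed.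

Definition dsub : A -> Prop := lin (gens (fun=> True)).

Lemma dsub_finite a : dsub a -> exists ws : seq {fset X}, lin (gens (fun w => w \in ws)) a.
Proof.
elim=> [|z g b [l [w [m [_ ->]]]] _ [ws IH]]; first by exists [::]; exact: lin0.
exists (w :: ws); apply: linS; first by exists l, w, m; rewrite mem_head.
apply: lin_mono IH => g' [l' [w' [m' [h ->]]]]; apply: lin_gen.
by exists l', w', m'; rewrite in_cons h orbT.
Qed.

(** Plays the part of an inner product space: by [fibre_inner], the products [y^* y'] are scalar
    multiples of [p w]. *)
Definition fibre w : A -> Prop := lin (fun a => exists l, a = pth l w).

Lemma fibre_dom w y : fibre w y -> cmul y (p w) = y.
Proof.
elim=> [|z g c [l ->] _ IH]; first by rewrite cmul0l.
by rewrite cmul_linearl IH pth_dom eqxx.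
Qed.

(** The graph has no cycles: each edge shrinks the vertex, so a path leading from [w] back to [w] is
    empty. *)
Lemma pth_inner l m w : exists K, cmul (cadj (pth l w)) (pth m w) = K *: p w.
Proof.
wlog le : l m / (size l <= size m)%N => [hw|].
  have [|/ltnW] := leqP (size l) (size m); first exact: hw.
  by case/hw => K e; exists K^*; rewrite -(family_adj F) -cadjZ -e cadjM cadjK.
have [->|[k [_ er _ ->]]] := pth_adj_mul w w le; first by exists 0; rewrite scale0r.
have [okk|/pth_out ->] := boolP (ok k w); last by exists 0; rewrite scale0r.
have /eqP := ok_card okk; rewrite er -{2}(addn0 #|` w|) eqn_add2l size_eq0 => /eqP ->.
by exists 1; rewrite scale1r.
Qed.

Lemma fibre_inner w y y' : fibre w y -> fibre w y' ->
  exists K, cmul (cadj y) y' = K *: p w.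
Proof.
move=> fy fy'; elim: fy => [|z g c [l ->] _ [K' hK']].
  by exists 0; rewrite cadj0 cmul0l scale0r.
suff [K hK] : exists K, cmul (cadj (pth l w)) y' = K *: p w.
  exists (z^* * K + K').
  by rewrite cadj_antilinear cmul_linearl hK hK' scalerA scalerDl.
elim: fy' => [|t g' c' [m ->] _ [K2 hK2]]; first by exists 0; rewrite cmul0r scale0r.
have [K hK] := pth_inner l m w; exists (t * K + K2).
by rewrite cmul_linearr hK hK2 scalerA scalerDl.
Qed.

(** Terms are collected by their right-hand path. [Y] is total and vanishes off [ks], so adding a
    generator is a pointwise update, whether or not its path has already occurred. *)
Lemma dsub_normal_form u : dsub u ->
  exists (ks : seq (seq X * {fset X})) (Y : seq X * {fset X} -> A),
    [/\ uniq ks, forall k : seq X * {fset X}, fibre k.2 (Y k),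
        forall k : seq X * {fset X}, k \notin ks -> Y k = 0
      & u = \sum_(k <- ks) cmul (Y k) (cadj (pth k.1 k.2))].
Proof.
elim=> [|z g b [l [w [m [_ ->]]]] _ [ks [Y [uks fY Y0 ->]]]].
  by exists [::], (fun=> 0); split=> // [k|]; [exact: lin0|rewrite big_nil].
set k0 := (m, w); pose Y' (k : seq X * {fset X}) := if k == k0 then z *: pth l w + Y k else Y k.
have fY' (k : seq X * {fset X}) : fibre k.2 (Y' k).
  rewrite /Y'; case: eqP => [->|_]; last exact: fY.
  by apply: linS; [exists l|exact: fY].
have Y'E (k : seq X * {fset X}) : k != k0 -> Y' k = Y k by rewrite /Y' => /negPf ->.
have Y'0 : Y' k0 = z *: pth l w + Y k0 by rewrite /Y' eqxx.
have [kin|kout] := boolP (k0 \in ks).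
  exists ks, Y'; split=> // [k kn|].
    by rewrite Y'E ?Y0 //; apply: contraNneq kn => ->.
  rewrite (bigD1_seq k0) //= [in RHS](bigD1_seq k0) //= addrA; congr (_ + _).
    by rewrite Y'0 cmulDl cmulZl.
  by apply: eq_bigr => k /Y'E ->.
exists (k0 :: ks), Y'; split=> //= [|k|]; first by rewrite kout.
  by rewrite in_cons negb_or => /andP[/Y'E -> /Y0].
rewrite big_cons Y'0 (Y0 _ kout) addr0 cmulZl; congr (_ + _).
by apply: eq_big_seq => k kk; rewrite Y'E //; apply: contraNneq kout => <-.
Qed.

Lemma pth_adj_fresh k w x W : k != [::] -> x \notin k ->
  cmul (cadj (pth k w)) (pth [:: x] W) = 0.
Proof.
case/lastP: k => // k g _; rewrite mem_rcons in_cons negb_or => /andP[xg _].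
rewrite -cats1 pth_cat cadjM -cmulA pth_orth // eqseq_cons eq_sym (negPf xg) /=.
by rewrite cmul0r.
Qed.

(* The path of minimal source isolates one term of the normal form: an initial
   segment of it would have a smaller source, and a longer path is killed by a
   final edge that it does not contain. *)
Lemma dsub_compress u : dsub u -> u <> 0 -> exists m w y (B : {fset X}),
  [/\ fibre w y, y <> 0 & forall x, x \notin B ->
    cmul u (cmul (pth m w) (pth [:: x] (x |` w)%fset))
    = cmul y (pth [:: x] (x |` w)%fset)].
Proof.
move=> /dsub_normal_form[ks [Y [uks fY _ ->]]] u0.
pose ks' := [seq k : seq X * {fset X} <- ks | ok k.1 k.2 && (Y k != 0)].
have sE : \sum_(k <- ks) cmul (Y k) (cadj (pth k.1 k.2))
    = \sum_(k <- ks') cmul (Y k) (cadj (pth k.1 k.2)).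
  rewrite big_filter [in RHS]big_mkcond /=; apply: eq_bigr => k _.
  case: ifP => // /negbT; rewrite negb_and negbK => /orP[/pth_out ->|/eqP ->].
    by rewrite cadj0 cmul0r.
  by rewrite cmul0l.
rewrite sE in u0 *; have uks' : uniq ks' by apply: filter_uniq.
have [k0 k0in k0min] : exists2 k0, k0 \in ks' &
    forall k : seq X * {fset X}, k \in ks' -> (#|` k0.2| <= #|` k.2|)%N.
  have [k1 k1in] : exists q, q \in ks'.
    apply: contrapT => nk; apply: u0; rewrite big_seq big1 // => k kin.
    by case: nk; exists k.
  have ex : exists n, has (fun k : seq X * {fset X} => #|` k.2| == n) ks'.
    by exists #|` k1.2|; apply/hasP; exists k1.
  case: (ex_minnP ex) => n /hasP[k0 kin /eqP ke] nmin; exists k0 => // k kin'.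
  by rewrite ke; apply: nmin; apply/hasP; exists k.
have := k0in; rewrite mem_filter => /andP[/andP[ok0 Y0] _].
set m0 := k0.1 in ok0 *; set w0 := k0.2 in ok0 k0min *.
(* All elements removed along the right-hand paths: an edge removing anything else is orthogonal to
   the last edge of each of them. *)
pose B := [fset x in flatten [seq k.1 | k : seq X * {fset X} <- ks']]%fset.
exists m0, w0, (Y k0), B; split; [exact: fY|exact/eqP|move=> x xB].
set q := pth [:: x] _.
rewrite cmul_suml (bigD1_seq k0) //= -cmulA (cmulA (cadj _)) pth_orth // -/m0 -/w0 !eqxx ok0 /=.
rewrite cmulA fibre_dom; last exact: fY.
rewrite big_seq_cond big1 ?addr0 // => k /andP[kin kn].
have xk : x \notin k.1.
  apply: contra xB => xk; rewrite inE; apply/flattenP; exists k.1 => //.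
  by apply: map_f.
rewrite -cmulA (cmulA (cadj _)).
have [sz|sz] := leqP (size k.1) (size m0).
  have [->|[j [ej er _ ->]]] := pth_adj_mul k.2 w0 sz; first by rewrite cmul0l cmul0r.
  have [okj|/pth_out ->] := boolP (ok j w0); last by rewrite cmul0l cmul0r.
  have := ok_card okj; have := k0min _ kin; rewrite er -/w0 => le.
  case: j ej er okj => [|g j] ej er okj; last first.
    by move=> e2; move: le; rewrite -e2 /= addnS ltnNge leq_addr.
  move=> _; move: kn; rewrite (surjective_pairing k) -er -[k.1]/([::] ++ k.1) -ej.
  by rewrite -surjective_pairing eqxx.
have -> : cmul (cadj (pth k.1 k.2)) (pth m0 w0)
    = cadj (cmul (cadj (pth m0 w0)) (pth k.1 k.2)) by rewrite cadjM cadjK.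
have [->|[j [ej er _ ->]]] := pth_adj_mul w0 k.2 (ltnW sz).
  by rewrite cadj0 cmul0l cmul0r.
rewrite pth_adj_fresh ?cmul0r //; first by apply: contraTneq sz => j0; rewrite ej j0 ltnn.
by apply: contra xk => xj; rewrite ej mem_cat xj.
Qed.

End Paths.

(** * Closures and dense *-subalgebras *)

Section Approximation.
Context {R : realType} {V : normedModType R[i]}.

Definition approximable (S : V -> Prop) (a : V) : Prop :=
  forall e : R, 0 < e -> exists b, S b /\ nrm (a - b) < e.

Lemma closed_approximable (S : set V) a : closed S -> approximable S a -> S a.
Proof.
move=> cS h; apply: cS => B /nbhs_ballP[e /= e0 Be].
have eE : e = (complex.Re e)%:C%C by rewrite RRe_real // gtr0_real.
have [|b [Sb ab]] := h (complex.Re e); first by rewrite -(@ltcR R) -eE.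
by exists b; split=> //; apply: Be; rewrite -ball_normE /= eE -nrm_lt.
Qed.

Lemma closure_approximable (S : set V) a : closure S a -> approximable S a.
Proof.
move=> cS e e0; have ec : 0 < e%:C%C :> R[i] by rewrite ltcR.
have [b [Sb]] := cS _ (nbhsx_ballx a _ ec); rewrite -ball_normE /= -nrm_lt => ab.
by exists b.
Qed.

Lemma approximable_approximable (S : V -> Prop) a :
  approximable (approximable S) a -> approximable S a.
Proof.
move=> h e e0; have e2 : 0 < e / 2 by rewrite divr_gt0.
have [b [/(_ _ e2)[c [Sc bc]] ab]] := h _ e2; exists c; split=> //.
have := nrmD (a - b) (b - c); rewrite addrA subrK; lra.
Qed.

Lemma approximable_closed (S : V -> Prop) : closed (approximable S : set V).
Proof. by move=> a /closure_approximable /approximable_approximable. Qed.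

Lemma approximable_self (S : V -> Prop) a : S a -> approximable S a.
Proof. by move=> Sa e e0; exists a; rewrite subrr nrm0. Qed.

Lemma approximable_linear (S : V -> Prop) : S 0 ->
  (forall z a b, S a -> S b -> S (z *: a + b)) ->
  forall z a b, approximable S a -> approximable S b -> approximable S (z *: a + b).
Proof.
move=> S0 SL z a b ha hb e e0; pose M := nrmc z + 1.
have M0 : 0 < M by rewrite ltr_pwDr // nrmc_ge0.
have [|a' [Sa' la]] := ha (e / 2 / M); first by rewrite !divr_gt0.
have [|b' [Sb' lb]] := hb (e / 2); first by rewrite divr_gt0.
exists (z *: a' + b'); split; first exact: SL.
have -> : z *: a + b - (z *: a' + b') = z *: (a - a') + (b - b').
  by rewrite scalerBr opprD addrACA.
have := nrmD (z *: (a - a')) (b - b'); rewrite nrmZ.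
have : nrmc z * nrm (a - a') <= M * (e / 2 / M).
  by rewrite ler_pM ?nrmc_ge0 ?nrm_ge0 // ltW // ltrDl.
by rewrite (mulrC M) divfK ?gt_eqF //; lra.
Qed.

End Approximation.

Section StarDense.
Context {R : realType} {A : cstarAlgebra R} (D : A -> Prop).
Hypotheses (D0 : D 0) (DL : forall z a b, D a -> D b -> D (z *: a + b)).
Hypotheses (DM : forall a b, D a -> D b -> D (cmul a b)).
Hypothesis DJ : forall a, D a -> D (cadj a).

Lemma approximable_cmul a b :
  approximable D a -> approximable D b -> approximable D (cmul a b).
Proof.
move=> ha hb e e0; pose M := nrm a + nrm b + 1.
have M1 : 1 <= M by rewrite lerDr addr_ge0 // nrm_ge0.
have M0 : 0 < M by lra.
(* The cap at 1 keeps [|a'|] below [|a| + 1], so that the fixed [M] controls both error terms. *)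
pose e' := Num.min 1 (e / 2 / M).
have e'0 : 0 < e' by rewrite lt_min ltr01 !divr_gt0.
have e'1 : e' <= 1 by rewrite ge_min lexx.
have e'2 : M * e' <= e / 2 by rewrite mulrC -ler_pdivlMr // ge_min lexx orbT.
have [a' [Da la]] := ha _ e'0; have [b' [Db lb]] := hb _ e'0.
exists (cmul a' b'); split; first exact: DM.
have -> : cmul a b - cmul a' b' = cmul (a - a') b + cmul a' (b - b').
  by rewrite cmulBl cmulBr addrA subrK.
have h1 := nrmD (cmul (a - a') b) (cmul a' (b - b')).
have h2 := nrm_cmul (a - a') b; have h3 := nrm_cmul a' (b - b').
have a'M : nrm a' <= nrm a + 1.
  by have := nrm_triB a' a; rewrite nrmB; lra.
have h4 : nrm (a - a') * nrm b <= e' * nrm b by rewrite ler_wpM2r ?nrm_ge0 // ltW.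
have h5 : nrm a' * nrm (b - b') <= (nrm a + 1) * nrm (b - b').
  by rewrite ler_wpM2r ?nrm_ge0.
have h6 : (nrm a + 1) * nrm (b - b') < (nrm a + 1) * e'.
  by rewrite ltr_pM2l // ltr_pwDr ?nrm_ge0.
have h7 : M * e' = e' * nrm b + (nrm a + 1) * e' by rewrite /M; ring.
lra.
Qed.

Lemma approximable_cadj a : approximable D a -> approximable D (cadj a).
Proof.
move=> ha e e0; have [b [Db ab]] := ha _ e0.
by exists (cadj b); split; [exact: DJ|rewrite -cadjB nrm_adj].
Qed.

Lemma generated_dense (G : set A) : cstar_generated G ->
  (forall g, G g -> approximable D g) -> forall a, approximable D a.
Proof.
move=> gG hG a.
have : (approximable D : set A) = setT.
  apply: gG => //; split.
  - exact: approximable_closed.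
  - by split; [exact: approximable_self|exact: approximable_linear].
  - exact: approximable_cmul.
  - exact: approximable_cadj.
by move/seteqP => [_ /(_ a I)].
Qed.

End StarDense.

(** * Primality *)

Section Ideals.
Context {R : realType} {A : cstarAlgebra R} {X : choiceType}.
Variables (p : {fset X} -> A) (s : X -> {fset X} -> A).
Hypothesis F : finset_family p s.
Hypothesis p_neq0 : forall v, p v <> 0.
Hypothesis fresh : forall B : {fset X}, exists x, x \notin B.
Hypothesis dense : forall a, approximable (dsub p s) a.

Lemma nrm_family v : nrm (p v) = 1.
Proof.
have n0 : nrm (p v) != 0 by rewrite nrm_eq0; apply/eqP.
apply: (mulfI n0); rewrite mulr1 -expr2 -nrm_adj_mul (family_adj F).
by rewrite (family_proj F) eqxx.
Qed.

(* With [r = q - q b q], the powers [r^n] tend to [0] and [q - r^n] lies in [I]. *)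
Lemma closed_ideal_projection (I : set A) q b : closed_ideal I ->
  cadj q = q -> cmul q q = q -> nrm q = 1 -> I b -> nrm (q - b) < 1 -> I q.
Proof.
move=> cI q_adj qq q1 Ib lt1; have [clI [I0 IL] Il Ir] := cI.
pose r := q - cmul (cmul q b) q.
have Iqr : I (q - r) by rewrite opprB addrC subrK; apply/Ir/Il.
have rE : r = cmul (cmul q (q - b)) q by rewrite cmulBr cmulBl !qq.
have r_le : nrm r <= nrm (q - b).
  rewrite rE (le_trans (nrm_cmul _ _)) // q1 mulr1.
  by rewrite (le_trans (nrm_cmul _ _)) // q1 mul1r.
pose rn n := iter n (cmul r) r.
have rq : cmul r q = r by rewrite rE -cmulA qq.
have Irn n : I (q - rn n).
  elim: n => [//|n IH]; rewrite /rn iterS -/(rn n).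
  have -> : q - cmul r (rn n) = (q - r) + cmul r (q - rn n).
    by rewrite cmulBr rq addrA subrK.
  by rewrite -[X in X + _]scale1r; apply: IL => //; apply: Il.
have rn_le n : nrm (rn n) <= nrm r ^+ n.+1.
  elim: n => [|n IH]; first by rewrite expr1.
  by rewrite exprS (le_trans (nrm_cmul _ _)) // ler_wpM2l // nrm_ge0.
apply: closed_approximable => // e e0.
have [n rne] : exists n, nrm r ^+ n.+1 < e.
  have r1 : `|nrm r| < 1 by rewrite ger0_norm ?nrm_ge0 //; lra.
  have /cvgrPdist_lt/(_ e e0)[n _ /(_ n.+1 (leqnSn n))] := cvg_expr r1.
  rewrite /= sub0r normrN => h; exists n; apply: le_lt_trans h; exact: ler_norm.
exists (q - rn n); split; first exact: Irn.
by rewrite opprB addrC subrK (le_lt_trans (rn_le n)).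
Qed.

Lemma dsub_selfadjoint_eigenvector h (rho : R) :
  dsub p s h -> cadj h = h -> 0 <= rho -> rho < nrm h ->
  exists z u, [/\ dsub p s u, u <> 0, cmul h u = z *: u & rho < nrmc z].
Proof.
move=> Dh h_sa rho0 lt_rho.
have [ws hws] := dsub_finite Dh; have [gs hgs] := lin_gens_findim F ws.
apply: (@selfadjoint_eigenvector _ _ h (dsub p s) _ _ _ gs) => //.
- by move=> z a b; apply: lin_linear.
- by move=> a Da; apply: lin_gens_mul.
- by move=> k; apply: hgs; elim: k => // k IH; apply: lin_gens_mul.
Qed.

(* Compressing an eigenvector of [h] to a path gives [q^* h q = z K p_W] with
   [q^* q = K p_W]. *)
Lemma selfadjoint_corner h (rho : R) :
  dsub p s h -> cadj h = h -> 0 <= rho -> rho < nrm h ->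
  exists z K q W, [/\ rho < nrmc z, K != 0, cmul h q = z *: q &
    cmul (cadj q) q = K *: p W].
Proof.
move=> Dh h_sa rho0 lt_rho.
have [z [u [Du u0 hu zrho]]] := dsub_selfadjoint_eigenvector Dh h_sa rho0 lt_rho.
have [m [w [y [B [fy y0 yE]]]]] := dsub_compress F Du u0.
have [x xB] := fresh (B `|` w)%fset.
have {xB} /andP[xB xw] : (x \notin B) && (x \notin w).
  by rewrite -negb_or -in_fsetU.
pose W := (x |` w)%fset; have xW : x \in W by apply: fset1U1.
have Ww : (W `\ x)%fset = w by rewrite fsetU1K.
have [K KE] := fibre_inner F fy fy.
have K0 : K != 0.
  by apply: contra_notN y0 => /eqP K0; apply: cadj_mul_eq0; rewrite KE K0 scale0r.
exists z, K, (cmul u (cmul (pth p s m w) (pth p s [:: x] W))), W.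
split=> //; first by rewrite cmulA hu cmulZl.
rewrite (yE _ xB) cadjM -cmulA (cmulA (cadj y)) KE cmulZl cmulZr.
rewrite -/W (pth_rng F) -[rng W [:: x]]/(W `\ x)%fset Ww eqxx.
by rewrite (pth_orth F) // !eqxx /= xW.
Qed.

Lemma closed_ideal_has_vertex (I : set A) : closed_ideal I -> I <> [set 0] ->
  exists v, I (p v).
Proof.
move=> cI In0; have [clI [I0 IL] Il Ir] := cI.
have [a0 Ia0 a00] : exists2 a, I a & a <> 0.
  apply: contrapT => h; apply: In0; apply/seteqP; split=> [a Ia|a ->//].
  by apply: contrapT => a0; apply: h; exists a.
pose a := cmul (cadj a0) a0; have Ia : I a by apply: Il.
have a_sa : cadj a = a by rewrite /a cadjM cadjK.
have c0 : 0 < nrm a.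
  by rewrite nrm_gt0; apply/eqP => /cadj_mul_eq0.
set c := nrm a in c0.
(* The error [c / 4] survives averaging [d] with its adjoint because [a] is selfadjoint. It leaves
   [|h| > c / 2], hence an eigenvalue with [|z| > c / 2], and the final quotient stays below
   [(c / 4) / (c / 2) < 1]. *)
have [|d [Dd ad]] := @dense a (c / 4); first by rewrite divr_gt0.
pose h := 2^-1 *: (d + cadj d).
have h_sa : cadj h = h by rewrite /h cadjZ fmorphV rmorph_nat cadjD cadjK addrC.
have Dh : dsub p s h by apply/linZ/linD => //; apply: lin_gens_adj.
have ah : nrm (a - h) < c / 4.
  have -> : a - h = 2^-1 *: ((a - d) + cadj (a - d)).
    rewrite cadjB a_sa addrACA -opprD scalerBr; congr (_ - _).
    by rewrite -(mulr2n a) -(scaler_nat 2 a) scalerA mulVf ?pnatr_eq0 // scale1r.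
  have n2 : nrmc (2^-1 : R[i]) = 2^-1.
    by rewrite nrmcV (_ : 2 = (2 : R)%:C%C) ?nrmcR ?ger0_norm // rmorph_nat.
  rewrite nrmZ n2; have := nrmD (a - d) (cadj (a - d)); rewrite nrm_adj; lra.
have hc : c / 2 < nrm h by have := nrm_triB a h; rewrite -/c; lra.
have [|z [K [q [W [zc K0 hq qq]]]]] := @selfadjoint_corner h (c / 2) Dh h_sa _ hc.
  by rewrite divr_ge0 // ltW.
(* With [h] in place of [a] this element would be exactly [p W]. *)
exists W; pose b := (z * K)^-1 *: cmul (cmul (cadj q) a) q.
have z0 : z != 0 by rewrite -nrmc_gt0; lra.
have zK0 : z * K != 0 by rewrite mulf_neq0.
have Ib : I b.
  by rewrite /b -[X in I X]addr0; apply: IL => //; apply/Ir/Il.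
apply: (closed_ideal_projection cI _ _ _ Ib); rewrite ?(family_adj F) ?nrm_family //.
  by rewrite (family_proj F) eqxx.
have -> : p W - b = (z * K)^-1 *: cmul (cmul (cadj q) (h - a)) q.
  rewrite cmulBr cmulBl scalerBr -/b -(cmulA _ h) hq cmulZr qq.
  by rewrite !scalerA -mulrA mulVf // scale1r.
rewrite nrmZ nrmcV nrmcM.
have q2 : nrm q ^+ 2 = nrmc K by rewrite -nrm_adj_mul qq nrmZ nrm_family mulr1.
have le : nrm (cmul (cmul (cadj q) (h - a)) q) <= nrm (h - a) * nrmc K.
  rewrite (le_trans (nrm_cmul _ _)) // -q2 expr2 mulrA ler_wpM2r ?nrm_ge0 //.
  by rewrite (le_trans (nrm_cmul _ _)) // nrm_adj mulrC.
have Kp : 0 < nrmc K by rewrite nrmc_gt0.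
rewrite mulrC ltr_pdivrMr ?mulr_gt0 ?mul1r //; last by lra.
rewrite (le_lt_trans le) // ltr_pM2r // nrmB; lra.
Qed.

Lemma path_to (v w : {fset X}) : (v `<=` w)%fset -> exists2 l, ok l w & rng w l = v.
Proof.
move=> vw; have [n nE] : exists n, #|` w| = (#|` v| + n)%N.
  by exists (#|` w| - #|` v|)%N; rewrite subnKC // fsubset_leq_card.
elim: n w vw nE => [|n IH] w vw nE.
  exists [::] => //=; apply/esym/eqP; rewrite eqEfcard vw nE addn0 leqnn //.
have [x xw xv] : exists2 x, x \in w & x \notin v.
  apply: contrapT => h; have wv : (w `<=` v)%fset.
    apply/fsubsetP => x xw; apply: contrapT => /negP xv; apply: h; exists x => //.
  by have := fsubset_leq_card wv; rewrite nE addnS -ltn_subRL subnn.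
have [||l okl rl] := IH (w `\ x)%fset.
- apply/fsubsetP => y yv; rewrite in_fsetD1 (fsubsetP vw) // andbT.
  by apply: contraNneq xv => <-.
- by have := cardfsD1 x w; rewrite xw nE addnS add1n => -[->].
- by exists (x :: l); rewrite //= xw.
Qed.

(** A path [l] from [w] down to [v] gives [p_w = S_l^* p_v S_l]. *)
Lemma closed_ideal_hereditary (I : set A) v w : closed_ideal I ->
  (v `<=` w)%fset -> I (p v) -> I (p w).
Proof.
case=> _ _ Il Ir /path_to[l okl rl] Iv.
have -> : p w = cmul (cadj (pth p s l w)) (cmul (p v) (pth p s l w)).
  by rewrite (pth_rng F) rl eqxx (pth_orth F) // !eqxx okl.
by apply/Il/Ir.
Qed.

Lemma finset_family_prime : prime_cstar A.
Proof.
move=> I1 I2 cI1 cI2 I0; apply: contrapT => /not_orP[n1 n2].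
have [v1 Iv1] := closed_ideal_has_vertex cI1 n1.
have [v2 Iv2] := closed_ideal_has_vertex cI2 n2.
have : (I1 `&` I2) (p (v1 `|` v2)%fset).
  split; first exact: closed_ideal_hereditary cI1 (fsubsetUl _ _) Iv1.
  exact: closed_ideal_hereditary cI2 (fsubsetUr _ _) Iv2.
by rewrite I0 => /p_neq0.
Qed.

End Ideals.

(** * Representations *)

Section SquareRoot.
Context {R : realType} {A : cstarAlgebra R}.
Implicit Types (a h k : A).

Lemma nrm_le_eps (V : normedModType R[i]) (x : V) (C : R) :
  (forall e : R, 0 < e -> nrm x <= C * e) -> x = 0.
Proof.
move=> h; apply/eqP; rewrite -nrm_eq0; apply/eqP/le_anti; rewrite nrm_ge0 andbT.
have C0 : 0 <= C by have := h 1 ltr01; rewrite mulr1; apply: le_trans (nrm_ge0 _).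
apply/ler_addgt0Pr => e e0; rewrite add0r.
have C1 : 0 < C + 1 by lra.
apply: le_trans (h (e / (C + 1)) _) _; first by rewrite divr_gt0.
by rewrite mulrCA ger_pMr // ler_pdivrMr // mul1r lerDl.
Qed.

Lemma seq_complete (V : completeNormedModType R[i]) (u : nat -> V) :
  (forall e : R, 0 < e -> exists n, forall m, (n <= m)%N -> nrm (u m - u n) < e) ->
  exists l, forall e : R, 0 < e -> exists n, forall m, (n <= m)%N -> nrm (u m - l) < e.
Proof.
move=> h; have /cauchy_cvg/cvg_ex[l ul] : cauchy (u @ \oo).
  apply: cauchy_exP => e e0; have eE : e = (complex.Re e)%:C%C.
    by rewrite RRe_real // gtr0_real.
  have [|n nP] := h (complex.Re e); first by rewrite -(@ltcR R) -eE.
  exists (u n), n => // m /= /nP; rewrite nrmB nrm_lt -eE => lt.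
  by rewrite -ball_normE.
exists l => e e0; have ec : 0 < e%:C%C :> R[i] by rewrite ltcR.
have /cvgrPdist_lt/(_ _ ec)[n _ nP] := ul.
by exists n => m /nP; rewrite /= nrmB nrm_lt.
Qed.

(* The fixed point of [k |-> (h + k^2) / 2] is [1 - sqrt (1 - h)]. *)
Lemma one_minus_sqrt h : cadj h = h -> nrm h <= 4^-1 ->
  exists2 k, cadj k = k & k + k = h + cmul k k.
Proof.
move=> h_sa h4; pose f k := 2^-1 *: (h + cmul k k).
have n2 : nrmc (2^-1 : R[i]) = 2^-1.
  by rewrite nrmcV (_ : 2 = (2 : R)%:C%C) ?nrmcR ?ger0_norm // rmorph_nat.
have ff k : f k + f k = h + cmul k k.
  rewrite -(mulr2n (f k)) -(scaler_nat 2 (f k)) scalerA mulfV ?pnatr_eq0 //.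
  by rewrite scale1r.
have sqD k k' : cmul k k - cmul k' k' = cmul k (k - k') + cmul (k - k') k'.
  by rewrite cmulBr cmulBl addrA subrK.
pose u n := iter n f 0.
(* The ball of radius 1/2 is stable under [f], as [(1/4 + 1/4) / 2 <= 1/2]. On it
   [|k^2 - k'^2| <= |k - k'|], so [f] contracts by the factor 1/2. *)
have u_le n : nrm (u n) <= 2^-1.
  elim: n => [|n IH]; first by rewrite nrm0 invr_ge0.
  rewrite /u iterS -/(u n) nrmZ n2.
  have := nrmD h (cmul (u n) (u n)); have := nrm_cmul (u n) (u n).
  have : nrm (u n) * nrm (u n) <= 2^-1 * 2^-1 by rewrite ler_pM ?nrm_ge0.
  lra.
have u_step n : nrm (u n.+1 - u n) <= 2^-1 ^+ n.
  elim: n => [|n IH].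
    rewrite expr0 -[u 0%N]/(0 : A) subr0; apply: le_trans (u_le 1%N) _; lra.
  rewrite {1}/u !iterS -/(u n) -[f (u n)]/(u n.+1) /f -scalerBr opprD addrACA subrr add0r.
  rewrite sqD nrmZ n2 exprS ler_wpM2l ?invr_ge0 //.
  set d := u n.+1 - u n in IH *.
  have := nrmD (cmul (u n.+1) d) (cmul d (u n)).
  have := nrm_cmul (u n.+1) d; have := nrm_cmul d (u n).
  have : nrm (u n.+1) * nrm d <= 2^-1 * nrm d by rewrite ler_wpM2r ?nrm_ge0.
  have : nrm d * nrm (u n) <= nrm d * 2^-1 by rewrite ler_wpM2l ?nrm_ge0.
  lra.
(* The bound is the geometric sum of the steps [2^-m] for [n <= m < n + j]. *)
have u_cauchy n j : nrm (u (n + j)%N - u n) <= 2 * 2^-1 ^+ n - 2 * 2^-1 ^+ (n + j).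
  elim: j => [|j IH]; first by rewrite addn0 !subrr nrm0.
  have := nrmD (u (n + j.+1)%N - u (n + j)%N) (u (n + j)%N - u n).
  have := u_step (n + j)%N; rewrite addrA subrK addnS exprS; lra.
have [k kP] : exists k, forall e : R, 0 < e ->
    exists n, forall m, (n <= m)%N -> nrm (u m - k) < e.
  apply: seq_complete => e e0.
  have r1 : `|2^-1 : R| < 1 by rewrite ger0_norm ?invr_ge0 //; lra.
  have e2 : 0 < e / 2 by rewrite divr_gt0.
  have /cvgrPdist_lt/(_ _ e2)[n _ /(_ n (leqnn n))] := cvg_expr r1.
  rewrite /= sub0r normrN ger0_norm ?exprn_ge0 ?invr_ge0 // => lt.
  exists n => m nm; rewrite -(subnKC nm); have := u_cauchy n (m - n)%N.
  have : 0 <= 2^-1 ^+ (n + (m - n)) :> R by rewrite exprn_ge0 ?invr_ge0.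
  lra.
have u_sa n : cadj (u n) = u n.
  elim: n => [|n IH]; first by rewrite cadj0.
  by rewrite /u iterS -/(u n) cadjZ fmorphV rmorph_nat cadjD h_sa cadjM IH.
exists k.
  apply/eqP; rewrite -subr_eq0; apply/eqP/(@nrm_le_eps _ _ 2) => e e0.
  have [n /(_ n (leqnn n)) lt] := kP e e0.
  have -> : cadj k - k = (u n - k) - cadj (u n - k).
    by rewrite cadjB u_sa addrAC opprB addrCA subrr addr0 addrC.
  have := nrmD (u n - k) (- cadj (u n - k)); rewrite nrmN nrm_adj; lra.
apply/eqP; rewrite -subr_eq0; apply/eqP/(@nrm_le_eps _ _ 4) => e e0.
have e1 : 0 < Num.min e 1 by rewrite lt_min e0 ltr01.
have [n nP] := kP _ e1.
have lt1 := nP _ (leqnn n); have lt2 := nP _ (leqnSn n).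
have le1 : Num.min e 1 <= e by rewrite ge_min lexx.
have le2 : Num.min e 1 <= 1 by rewrite ge_min lexx orbT.
have k_le : nrm k <= 3 / 2.
  by have := nrm_triB k (u n); have := u_le n; rewrite nrmB; lra.
have -> : k + k - (h + cmul k k)
    = (cmul (u n) (u n) - cmul k k) - ((u n.+1 - k) + (u n.+1 - k)).
  rewrite [X in _ = _ - X]addrACA -[u n.+1]/(f (u n)) ff -opprD opprB addrC.
  rewrite [RHS]addrC -addrA addrC; congr (_ + _).
  by rewrite !opprD -addrA addKr.
rewrite sqD; set d := u n - k in lt1 *; set d' := u n.+1 - k in lt2 *.
have := nrmD (cmul (u n) d + cmul d k) (- (d' + d')); rewrite nrmN.
have := nrmD (cmul (u n) d) (cmul d k); have := nrmD d' d'.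
have := nrm_cmul (u n) d; have := nrm_cmul d k.
have : nrm (u n) * nrm d <= 2^-1 * nrm d by rewrite ler_wpM2r ?nrm_ge0.
have : nrm d * nrm k <= nrm d * (3 / 2) by rewrite ler_wpM2l ?nrm_ge0.
lra.
Qed.

End SquareRoot.

Section RepresentationBound.
Context {R : realType} {A : cstarAlgebra R} {H : hilbertSpace R} (pi : A -> H -> H).
Hypothesis rpi : representation pi.

Lemma hdotDr (x y z : H) : hdot x (y + z) = hdot x y + hdot x z.
Proof. by have := hdot_linear 1 x y z; rewrite scale1r mul1r. Qed.
Lemma hdot0r (x : H) : hdot x 0 = 0.
Proof. by apply: (@addrI _ (hdot x 0)); rewrite -hdotDr !addr0. Qed.
Lemma hdotNr (x y : H) : hdot x (- y) = - hdot x y.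
Proof. by apply: (@addrI _ (hdot x y)); rewrite -hdotDr !subrr hdot0r. Qed.
Lemma hdotBr (x y z : H) : hdot x (y - z) = hdot x y - hdot x z.
Proof. by rewrite hdotDr hdotNr. Qed.
Lemma hdotBl (x y z : H) : hdot (y - z) x = hdot y x - hdot z x.
Proof. by rewrite hdot_conj hdotBr rmorphB /= -!hdot_conj. Qed.

Lemma repDl a b x : pi (a + b) x = pi a x + pi b x.
Proof. by have [_ _ h _ _] := rpi; have := h 1 a b x; rewrite !scale1r. Qed.
Lemma rep0l x : pi 0 x = 0.
Proof. by apply: (@addrI _ (pi 0 x)); rewrite -repDl !addr0. Qed.
Lemma repZl z a x : pi (z *: a) x = z *: pi a x.
Proof. by have [_ _ h _ _] := rpi; have := h z a 0 x; rewrite rep0l !addr0. Qed.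
Lemma repBl a b x : pi (a - b) x = pi a x - pi b x.
Proof. by rewrite repDl -scaleN1r repZl scaleN1r. Qed.
Lemma repDr a x y : pi a (x + y) = pi a x + pi a y.
Proof. by have [h _ _ _ _] := rpi; have := h a 1 x y; rewrite !scale1r. Qed.
Lemma rep0r a : pi a 0 = 0.
Proof. by apply: (@addrI _ (pi a 0)); rewrite -repDr !addr0. Qed.
Lemma repZr z a x : pi a (z *: x) = z *: pi a x.
Proof. by have [h _ _ _ _] := rpi; have := h a z x 0; rewrite rep0r !addr0. Qed.
Lemma repBr a x y : pi a (x - y) = pi a x - pi a y.
Proof. by rewrite repDr -scaleN1r repZr scaleN1r. Qed.
Lemma repM a b x : pi (cmul a b) x = pi a (pi b x).
Proof. by have [_ _ _ h _] := rpi. Qed.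
Lemma rep_adj a x y : hdot (pi (cadj a) x) y = hdot x (pi a y).
Proof. by have [_ _ _ _ h] := rpi. Qed.
Lemma rep_norm a x : hdot x (pi (cmul (cadj a) a) x) = `|pi a x| ^+ 2.
Proof. by rewrite repM -rep_adj cadjK hdot_norm. Qed.

Lemma le_nrm_sqr (x y : H) : (nrm x ^+ 2 <= nrm y ^+ 2) = (`|x| ^+ 2 <= `|y| ^+ 2).
Proof. by rewrite !nrmE -!rmorphXn /= lecR. Qed.

(* With [h = a^* a = 1 - (1 - k)^2] the defect [|x|^2 - |pi a x|^2] is the square
   norm of [x - pi k x]. *)
Lemma rep_contractive a x : nrm a <= 2^-1 -> nrm (pi a x) <= nrm x.
Proof.
move=> a2; pose h := cmul (cadj a) a.
have h_sa : cadj h = h by rewrite /h cadjM cadjK.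
have h4 : nrm h <= 4^-1.
  rewrite nrm_adj_mul expr2 (_ : 4^-1 = 2^-1 * 2^-1 :> R); last by lra.
  by rewrite ler_pM ?nrm_ge0.
have [k k_sa kE] := one_minus_sqrt h_sa h4.
rewrite -(ler_pXn2r (n := 2)) ?nnegrE ?nrm_ge0 // le_nrm_sqr.
have : 0 <= `|x - pi k x| ^+ 2 by rewrite exprn_ge0.
rewrite -hdot_norm hdotBr !hdotBl -{1}k_sa rep_adj.
have -> : hdot (pi k x) (pi k x) = hdot x (pi (cmul k k) x).
  by rewrite -{1}k_sa rep_adj repM.
rewrite -addrA -opprD -!hdotBr -hdotDr -repBl -repDl addrA kE addrK -subr_ge0.
by rewrite subr0 rep_norm hdot_norm subr_ge0.
Qed.

(** Scaling [a] to norm 1/2 brings it within reach of [rep_contractive], whence the factor 2. This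
    makes [a |-> pi a x] continuous in [a]. *)
Lemma rep_bound a x : nrm (pi a x) <= 2 * nrm a * nrm x.
Proof.
have [->|a0] := eqVneq a 0; first by rewrite rep0l !nrm0 mulr0 mul0r.
have ap : 0 < nrm a by rewrite nrm_gt0.
pose c := (2 * nrm a)^-1; have cp : 0 < c by rewrite invr_gt0 mulr_gt0.
have := @rep_contractive (c%:C%C *: a) x; rewrite repZl !nrmZ nrmcR gtr0_norm //.
rewrite {1}/c invfM mulfVK ?gt_eqF // => /(_ (lexx _)).
by rewrite /c ler_pdivrMl // mulr_gt0.
Qed.

End RepresentationBound.

(** * Countability forced by a faithful irreducible representation *)

Section NotPrimitive.
Context {R : realType} {A : cstarAlgebra R} {X : choiceType}.
Variables (p : {fset X} -> A) (s : X -> {fset X} -> A).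
Hypothesis F : finset_family p s.
Hypothesis p_neq0 : forall v, p v <> 0.
Hypothesis dense : forall a, approximable (dsub p s) a.
Variables (H : hilbertSpace R) (pi : A -> H -> H).
Hypothesis rpi : representation pi.

Let pathdeg xi (k : seq X * {fset X}) : R := nrm (pi (cadj (pth p s k.1 k.2)) xi) ^+ 2.

(** Paths of equal length have orthogonal ranges, so [P] is a projection and the defect
    [|xi|^2 - <xi, P xi>] equals [|xi - P xi|^2]. *)
Lemma path_bessel xi n (ks : seq (seq X * {fset X})) : uniq ks ->
  (forall k : seq X * {fset X}, k \in ks -> size k.1 = n) ->
  \sum_(k <- ks) pathdeg xi k <= nrm xi ^+ 2.
Proof.
move=> uks szk; pose P := \sum_(k <- ks) gen p s k.1 k.2 k.1.
have P_sa : cadj P = P.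
  rewrite /P; elim: (ks) => [|k r IH]; first by rewrite big_nil cadj0.
  by rewrite big_cons cadjD IH gen_adj.
have PP : cmul P P = P.
  rewrite {2}/P cmul_sumr {2}/P big_seq [RHS]big_seq; apply: eq_bigr => k kin.
  rewrite /P cmul_suml (bigD1_seq k) //= big_seq_cond.
  rewrite big1 ?addr0 => [|j /andP[jin jk]]; rewrite /gen -cmulA (cmulA (cadj _)).
    rewrite (pth_orth F) // !eqxx; case: ifP => [_|/negbT/(pth_out F) ->].
      by rewrite cmulA (pth_dom F) eqxx.
    by rewrite !cmul0l.
  rewrite (pth_orth F) ?szk // ifF ?cmul0l ?cmul0r //.
  apply: contraNF jk => /and3P[/eqP e1 /eqP e2 _].
  by rewrite (surjective_pairing j) e1 e2 -surjective_pairing.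
have sE : (\sum_(k <- ks) pathdeg xi k)%:C%C = hdot xi (pi P xi).
  rewrite /P; elim: (ks) => [|k r IH]; first by rewrite !big_nil rep0l // hdot0r.
  rewrite !big_cons rmorphD /= IH repDl // hdotDr; congr (_ + _).
  by rewrite /pathdeg rmorphXn /= -nrmE -rep_norm // cadjK.
rewrite -lecR sE rmorphXn /= -nrmE -hdot_norm -subr_ge0 -hdotBr.
have -> : hdot xi (xi - pi P xi) = `|xi - pi P xi| ^+ 2.
  rewrite -hdot_norm [RHS]hdotBl // -[X in hdot (pi X _) _]P_sa rep_adj //.
  by rewrite repBr // -repM // PP subrr hdot0r subr0.
by rewrite exprn_ge0.
Qed.

(** Sorting by length and by a lower bound [1 / (j + 1)] for [pathdeg] gives finite sets: by
    [path_bessel], each has at most [|xi|^2 (j + 1)] elements. *)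
Lemma countable_active_paths xi :
  countable [set k : seq X * {fset X} | pi (cadj (pth p s k.1 k.2)) xi <> 0].
Proof.
pose S n j := [set k : seq X * {fset X} | size k.1 = n /\ j.+1%:R^-1 < pathdeg xi k].
have finS n j : finite_set (S n j).
  apply: contrapT => infS.
  have [B BS Bsz] := infinite_set_fset (Num.bound (nrm xi ^+ 2 * j.+1%:R)).+1 infS.
  have le1 : \sum_(k <- B) pathdeg xi k <= nrm xi ^+ 2.
    apply: (@path_bessel xi n); first exact: fset_uniq.
    by move=> k /BS [].
  have le2 : \sum_(k <- B) j.+1%:R^-1 <= \sum_(k <- B) pathdeg xi k.
    by rewrite big_seq [leRHS]big_seq; apply: ler_sum => k /BS[_ /ltW].
  have sum_const (r : seq (seq X * {fset X})) (c : R) : \sum_(k <- r) c = c *+ size r.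
    by elim: r => [|k r IH]; rewrite ?big_nil // big_cons IH mulrS.
  rewrite sum_const in le2.
  have := le_trans le2 le1; rewrite -[_ *+ _]mulr_natl ler_pdivrMr ?ltr0n // => le3.
  have := archi_boundP (mulr_ge0 (exprn_ge0 2 (nrm_ge0 xi)) (ler0n R j.+1)).
  move=> lt; have := le_lt_trans le3 lt; rewrite ltr_nat => lt2.
  by move: (ltn_trans lt2 Bsz); rewrite ltnn.
apply: (@sub_countable _ _ _ (\bigcup_(i in [set: nat * nat]) S i.1 i.2)).
  apply: subset_card_le => k /= k0.
  have kp : 0 < pathdeg xi k by rewrite exprn_gt0 // nrm_gt0; apply/eqP.
  exists (size k.1, Num.bound (pathdeg xi k)^-1) => //; split=> //=.
  rewrite -[ltRHS]invrK ltf_pV2 ?posrE ?ltr0n ?invr_gt0 //.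
  apply: lt_le_trans (archi_boundP _) _; first by rewrite invr_ge0 ltW.
  by rewrite ler_nat.
by apply: bigcup_countable => // i _; exact: finite_set_countable.
Qed.

(** Any [xi] not killed by [A] will do. Without a unit [xi] is not evidently in the closure of its
    orbit, but the nonzero vector [pi a xi] is, and this rules out the zero subspace. *)
Lemma cyclic_vector : irreducible pi ->
  exists xi, forall y, approximable (fun z => exists a, z = pi a xi) y.
Proof.
case=> -[a [xi axi]] irr; exists xi => y.
pose S : set H := approximable (fun z => exists a, z = pi a xi).
have lin z x1 x2 : (exists a, x1 = pi a xi) -> (exists a, x2 = pi a xi) ->
    exists a, z *: x1 + x2 = pi a xi.
  by move=> [a1 ->] [a2 ->]; exists (z *: a1 + a2); rewrite repDl // repZl.
have S00 : exists a, 0 = pi a xi by exists 0; rewrite rep0l.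
have [|||S0|ST] := irr S.
- exact: approximable_closed.
- by split; [exact: approximable_self|exact: approximable_linear].
- move=> b x Sx e e0; pose M := 2 * nrm b + 1.
  have M0 : 0 < M by rewrite ltr_wpDl // mulr_ge0 // nrm_ge0.
  have [|_ [[c ->] lt]] := Sx (e / M); first by rewrite divr_gt0.
  exists (pi b (pi c xi)); split; first by exists (cmul b c); rewrite repM.
  rewrite -repBr //; apply: le_lt_trans (rep_bound rpi _ _) _.
  apply: le_lt_trans (_ : M * nrm (x - pi c xi) < _).
    by rewrite ler_wpM2r ?nrm_ge0 // lerDl.
  by rewrite mulrC -ltr_pdivlMr.
- have : S (pi a xi) by apply: approximable_self; exists a.
  by rewrite S0 => /eqP; rewrite (negPf axi).
- by have : S y by rewrite ST.
Qed.

Lemma rng_sub (w : {fset X}) l : (rng w l `<=` w)%fset.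
Proof.
elim: l w => [|x l IH] w /=; first exact: fsubset_refl.
exact: fsubset_trans (IH _) (fsubD1set _ _).
Qed.

(** The projection of the singleton vertex [{x}] acts nontrivially, so by density it does not kill
    some [S_l S_m^* xi]. Then [l] ends at [{x}], so the common source of [l] and [m] contains [x],
    and [S_m^* xi <> 0]. *)
Lemma active_path_through xi : faithful pi ->
  (forall y, approximable (fun z => exists a, z = pi a xi) y) ->
  forall x, exists k : seq X * {fset X},
    x \in k.2 /\ pi (cadj (pth p s k.1 k.2)) xi <> 0.
Proof.
move=> fpi cyc x; pose q := p [fset x]%fset.
have [eta qeta] : exists eta, pi q eta <> 0.
  by apply: contrapT => h; apply: (p_neq0 (v := [fset x]%fset)); apply: fpi => y;
     apply: contrapT => y0; apply: h; exists y.
have qp : 0 < nrm (pi q eta) by rewrite nrm_gt0; apply/eqP.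
have q1 : nrm q = 1 := nrm_family F p_neq0 _.
have [|_ [[a ->] lt]] := cyc eta (nrm (pi q eta) / 2); first by rewrite divr_gt0.
have qa : pi q (pi a xi) <> 0.
  move=> q0; have := rep_bound rpi q (eta - pi a xi).
  by rewrite repBr // q0 subr0 q1; lra.
have [d [Dd qd]] : exists d, dsub p s d /\ pi q (pi d xi) <> 0.
  have np : 0 < nrm (pi q (pi a xi)) by rewrite nrm_gt0; apply/eqP.
  (* [rep_bound] is used twice, for [q] of norm 1 and for [a - d]; each use costs a factor 2. *)
  pose M := 4 * nrm xi + 1; have M0 : 0 < M by rewrite ltr_wpDl // mulr_ge0 // nrm_ge0.
  have [|d [Dd ad]] := dense a (e := nrm (pi q (pi a xi)) / M); first by rewrite divr_gt0.
  exists d; split=> // q0; have := rep_bound rpi q (pi (a - d) xi).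
  rewrite {1}repBl // repBr // q0 subr0 q1; have := rep_bound rpi (a - d) xi.
  move: ad; rewrite ltr_pdivlMr // /M mulrDr mulr1.
  have := nrm_ge0 (a - d); lra.
have [l [w [m gq]]] : exists l w m, pi q (pi (gen p s l w m) xi) <> 0.
  apply: contrapT => h; apply: qd; elim: Dd => [|z g c [l [w [m [_ ->]]]] _ IH].
    by rewrite rep0l // rep0r.
  rewrite repDl // repZl // repDr // repZr // IH addr0.
  by rewrite (_ : pi q _ = 0) ?scaler0 //; apply: contrapT => g0; apply: h; exists l, w, m.
exists (m, w); split; last first.
  by move=> m0; apply: gq; rewrite /gen repM // m0 !rep0r.
move: gq; rewrite -repM // /gen cmulA (pth_rng F); case: eqP => [e _|_].
  by apply: (fsubsetP (rng_sub w l)); rewrite -e inE.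
by rewrite cmul0l rep0l.
Qed.

Lemma faithful_irreducible_countable : faithful pi -> irreducible pi -> countable [set: X].
Proof.
move=> fpi /cyclic_vector[xi cyc].
have act := active_path_through fpi cyc.
apply: (@sub_countable _ _ _ (\bigcup_(k in [set k : seq X * {fset X} |
   pi (cadj (pth p s k.1 k.2)) xi <> 0]) [set x | x \in k.2])).
  by apply: subset_card_le => x _; have [k [xk k0]] := act x; exists k.
apply: bigcup_countable; first exact: countable_active_paths.
by move=> k _; apply: finite_set_countable; exact: finite_fset.
Qed.

End NotPrimitive.

(** * Toeplitz pairs of the graph of finite subsets *)

Section Discrete.
Context {R : realType}.
Local Notation C := R[i].

(** Compactness is applied to the filter of finite sets directed by inclusion: a set eventually
    contains each given point, hence some finite set contains all of [K]. *)
Lemma discrete_compactP (T : choiceType) (K : set (discrete_topology T)) :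
  compact K <-> finite_set K.
Proof.
split; last exact: finite_compact.
move=> /compact_near_coveringP cK.
have tot : ProperFilter (@summability.totally T) := summability.totally_filter.
have : \forall B \near summability.totally, K `<=` (fun x : T => x \in (B : {fset T})).
  apply: cK => x Kx; exists ([set x], [set B : {fset T} | [fset (x : T)] `<=` B]%fset) => /=.
    by split; [exact: discrete_set1|exists [fset (x : T)]%fset].
  by move=> [y B] /= [-> xB]; apply: (fsubsetP xB); rewrite inE.
by case=> B _ KB; apply: sub_finite_set (KB B (fsubset_refl _)) (finite_fset B).
Qed.

Lemma C0P (T : choiceType) (f : discrete_topology T -> C) :
  C0 f <-> forall eps : R, 0 < eps -> finite_set [set x | eps <= nrmc (f x)].
Proof.
split=> [[_ h] eps eps0|h].
  have /h/discrete_compactP : 0 < eps%:C%C :> C by rewrite ltcR.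
  by apply: sub_finite_set => x /=; rewrite nrmcE lecR.
split=> [|eps eps0]; first exact: discrete_continuous.
have eE : eps = (complex.Re eps)%:C%C by rewrite RRe_real // gtr0_real.
apply/discrete_compactP; apply: sub_finite_set (h (complex.Re eps) _).
  by move=> x /=; rewrite nrmcE {1}eE lecR.
by rewrite -(@ltcR R) -eE.
Qed.

Lemma sum_finite (J : choiceType) (G : J -> C^o) (B : {fset J}) :
  (forall j, j \in B) ->
  summability.partial_sum G @ summability.totally --> (\sum_(j <- B) G j : C^o).
Proof.
move=> hB; have tot : ProperFilter (@summability.totally J) := summability.totally_filter.
apply: cvg_near_cst; exists B => // B' /= BB'.
rewrite /summability.partial_sum -(big_seq_fsetE _ B' xpredT G).
by congr bigop; congr enum_fset; apply/fsetP => j; rewrite hB (fsubsetP BB').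
Qed.

End Discrete.

Section FinsetGraph.
Context {R : realType} {X : choiceType}.
Local Notation C := R[i].
Local Notation V := (vertex (finsetGraph X)).
Local Notation W := (edge (finsetGraph X)).
Implicit Types (xi eta : W -> C) (x y : X) (v w : {fset X}).

(* [xi (x; v)], and [0] when [x] is not in [v] *)
Definition edge_val xi x v : C :=
  if insub (x, v) is Some e then xi (e : finsetEdge X) else 0.

Lemma edge_valE xi (e : finsetEdge X) : edge_val xi (val e).1 (val e).2 = xi e.
Proof. by rewrite /edge_val -surjective_pairing valK. Qed.

Lemma edge_val_in xi x v (xv : x \in v) : edge_val xi x v = xi (exist _ (x, v) xv).
Proof. by rewrite -[RHS]edge_valE. Qed.

Lemma edge_val_out xi x v : x \notin v -> edge_val xi x v = 0.
Proof. by move=> xv; rewrite /edge_val insubN. Qed.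

(** Sending an edge to the element it removes is a bijection from the fibre of [gdom] over [v] onto
    [v]; unconditional sums over fibres thus become finite sums. *)
Lemma fibre_sum (G : W -> C) v : exists B : {fset (@gdom (finsetGraph X) @^-1` [set v])},
  (forall j, j \in B) /\
  \sum_(j <- B) G (val j) = \sum_(x <- v) edge_val G x v.
Proof.
pose f (j : @gdom (finsetGraph X) @^-1` [set v]) : X := (val (val j : finsetEdge X)).1.
have jv (j : @gdom (finsetGraph X) @^-1` [set v]) : (val (val j : finsetEdge X)).2 = v.
  exact: (set_valP j).
have fv j : f j \in v.
  by have : f j \in (val (val j : finsetEdge X)).2 := valP (val j : finsetEdge X); rewrite jv.
have finj : injective f.
  move=> j j' e; apply/val_inj/val_inj.
  by rewrite (surjective_pairing (val (val j))) (surjective_pairing (val (val j'))) !jv -/(f j) e.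
have fin : finite_set [set: @gdom (finsetGraph X) @^-1` [set v]].
  apply: sub_finite_set (finite_preimage (B := [set` v]) (f := f) _ (finite_fset v)).
    by move=> j _; exact: fv.
  by move=> j j' _ _; exact: finj.
exists (fset_set setT); split=> [j|]; first by rewrite in_fset_set // inE.
rewrite (eq_bigr (fun j => edge_val G (f j) v)); last first.
  by move=> j _; rewrite -(edge_valE G (val j)) jv.
rewrite -(big_map f xpredT (fun x => edge_val G x v)); apply: perm_big.
apply: uniq_perm; [by rewrite map_inj_uniq // fset_uniq|exact: fset_uniq|move=> x].
apply/mapP/idP => [[j _ ->]|xv]; first exact: fv.
pose e : W := (exist _ (x, v) xv : finsetEdge X).
have ev : e \in @gdom (finsetGraph X) @^-1` [set v] by rewrite inE.
pose j : @gdom (finsetGraph X) @^-1` [set v] := @exist W (fun e => e \in _) e ev.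
by exists j; rewrite // in_fset_set // inE.
Qed.

Lemma innerE xi eta v :
  inner xi eta v = \sum_(x <- v) (edge_val xi x v)^* * edge_val eta x v.
Proof.
have [B [hB sB]] := fibre_sum (fun e => (xi e)^* * eta e) v.
have tot : ProperFilter (@summability.totally (@gdom (finsetGraph X) @^-1` [set v])).
  exact: summability.totally_filter.
rewrite /inner /summability.sum.
rewrite (cvg_lim (@norm_hausdorff _ _) (@sum_finite R _ _ _ hB)) sB.
rewrite big_seq [RHS]big_seq; apply: eq_bigr => x xv.
by rewrite !(edge_val_in _ xv).
Qed.

(** Continuity is automatic on a discrete space, and the fibres are finite. *)
Lemma CdP xi : Cd (finsetGraph X) xi <-> C0 (inner xi xi : V -> C).
Proof.
split=> [[]//|c0]; split=> // [|v]; first exact: discrete_continuous.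
have [B [hB _]] := fibre_sum (fun=> 0) v; apply/cvg_ex.
by eexists; exact: (@sum_finite R _ (fun j => `|xi (val j)| ^+ 2) _ hB).
Qed.

Definition vdelta v : V -> C := fun u => ((u : {fset X}) == v)%:R.
Definition edelta x v : W -> C := fun e => (val (e : finsetEdge X) == (x, v))%:R.

Lemma finitely_supported_C0 (f : V -> C) (B : {fset {fset X}}) :
  (forall v, v \notin B -> f v = 0) -> C0 f.
Proof.
move=> h; apply/C0P => eps eps0; apply: sub_finite_set (finite_fset B) => v /= le.
apply/negPn/negP => /h f0; move: le; rewrite f0 /nrmc normr0 /=; lra.
Qed.

Lemma C0_vdelta v : C0 (vdelta v).
Proof.
apply: (@finitely_supported_C0 _ [fset v]%fset) => u.
by rewrite in_fset1 /vdelta => /negPf ->.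
Qed.

Lemma edge_val_edelta x v y w : edge_val (edelta x v) y w = ((y \in w) && ((y, w) == (x, v)))%:R.
Proof.
have [yw|yw] := boolP (y \in w); last by rewrite edge_val_out.
by rewrite (edge_val_in _ yw).
Qed.

Lemma inner_edelta x y w v : x \in w ->
  inner (edelta x w) (edelta y v) = if (x == y) && (w == v) then vdelta w else fun=> 0.
Proof.
move=> xw; apply/funext => u; rewrite innerE.
have [->|uw] := eqVneq u w; last first.
  rewrite big1; first by case: ifP => // _; rewrite /vdelta (negPf uw).
  by move=> z _; rewrite edge_val_edelta xpair_eqE (negPf uw) !andbF conjC0 mul0r.
rewrite (bigD1_seq x) ?fset_uniq //= big1 ?addr0; last first.
  by move=> z /negPf zx; rewrite edge_val_edelta xpair_eqE zx andbF conjC0 mul0r.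
rewrite !edge_val_edelta xw !eqxx /= conjC1 mul1r xpair_eqE.
by case: ifP; rewrite // /vdelta eqxx.
Qed.

Lemma finitely_supported_Cd xi (B : {fset {fset X}}) :
  (forall e : finsetEdge X, (val e).2 \notin B -> xi e = 0) -> Cd (finsetGraph X) xi.
Proof.
move=> h; apply/CdP; apply: (@finitely_supported_C0 _ B) => v vB.
rewrite innerE big_seq big1 // => x xv; rewrite (edge_val_in _ xv) h ?conjC0 ?mul0r //.
Qed.

Lemma Cd_edelta x v : Cd (finsetGraph X) (edelta x v).
Proof.
apply: (@finitely_supported_Cd _ [fset v]%fset) => e; rewrite in_fset1.
by move=> ne; rewrite /edelta (surjective_pairing (val e)) xpair_eqE (negPf ne) andbF.
Qed.

Lemma inner_ge0 xi v : 0 <= inner xi xi v.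
Proof. by rewrite innerE sumr_ge0 // => x _; rewrite mulrC mul_conjC_ge0. Qed.

End FinsetGraph.

Definition members (X : choiceType) (F : seq {fset X}) : seq (X * {fset X}) :=
  flatten [seq [seq (x, v) | x <- enum_fset v] | v : {fset X} <- F].

Lemma mem_members (X : choiceType) (F : seq {fset X}) (q : X * {fset X}) :
  q.1 \in q.2 -> (q \in members F) = (q.2 \in F).
Proof.
case: q => y w /= yw; apply/idP/idP => [/flattenP[l]|wF].
  by case/mapP => v vF -> /mapP[x _ [_ ->]].
apply/flattenP; exists [seq (x, w) | x <- enum_fset w]; first by apply/mapP; exists w.
by apply/mapP; exists y.
Qed.

Section ToeplitzPair.
Context {R : realType} {X : choiceType} {A : cstarAlgebra R}.
Local Notation C := R[i].
Local Notation V := (vertex (finsetGraph X)).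
Local Notation W := (edge (finsetGraph X)).
Variables (t0 : (V -> C) -> A) (t1 : (W -> C) -> A).
Hypothesis T : toeplitz_pair t0 t1.

Let p (v : {fset X}) := t0 (vdelta v).
Let s (x : X) (v : {fset X}) := t1 (edelta x v).

Lemma C0_0 : C0 (fun _ : V => 0 : C).
Proof. exact: (@finitely_supported_C0 _ _ _ fset0). Qed.

Lemma Cd_0 : Cd (finsetGraph X) (fun _ : W => 0 : C).
Proof. exact: (@finitely_supported_Cd _ _ _ fset0). Qed.

Lemma pair_t0_0 : t0 (fun=> 0) = 0.
Proof.
have := T0_linear T (-1) C0_0 C0_0; rewrite scaleN1r addNr => <-.
by congr t0; apply/funext => v; rewrite mulr0 addr0.
Qed.

Lemma pair_t1_0 : t1 (fun=> 0) = 0.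
Proof.
have := T1_linear T (-1) Cd_0 Cd_0; rewrite scaleN1r addNr => <-.
by congr t1; apply/funext => v; rewrite mulr0 addr0.
Qed.

Lemma pair_t0D f g : C0 f -> C0 g -> t0 (fun v => f v + g v) = t0 f + t0 g.
Proof.
move=> cf cg; have := T0_linear T 1 cf cg; rewrite scale1r => <-.
by congr t0; apply/funext => v; rewrite mul1r.
Qed.

Lemma pair_t0Z z f : C0 f -> t0 (fun v => z * f v) = z *: t0 f.
Proof.
move=> cf; have := T0_linear T z cf C0_0; rewrite pair_t0_0 addr0 => <-.
by congr t0; apply/funext => v; rewrite addr0.
Qed.

Lemma pair_family : finset_family p s.
Proof.
split=> [v|v w|x w xw|x y w v xw|v x w]; rewrite /p /s.
- rewrite -(T0_adj T (C0_vdelta v)); congr t0; apply/funext => u.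
  by rewrite /vdelta conjC_nat.
- rewrite -(T0_mul T (C0_vdelta v) (C0_vdelta w)).
  case: eqVneq => [->|vw]; [congr t0|rewrite -pair_t0_0; congr t0];
    apply/funext => u; rewrite /vdelta.
    by case: eqP; rewrite ?mulr1 ?mulr0.
  by have [->|_] := eqVneq (u : {fset X}) v; rewrite ?mul0r // (negPf vw) mulr0.
- rewrite -pair_t1_0; congr t1; apply/funext => e; rewrite /edelta.
  case: eqP => // ee; have := valP (e : finsetEdge X); rewrite ee /=.
  by rewrite (negPf xw).
- rewrite (T1_inner T (Cd_edelta x w) (Cd_edelta y v)) inner_edelta //.
  by case: ifP => // _; exact: pair_t0_0.
- rewrite (T0_T1 T (C0_vdelta v) (Cd_edelta x w)).
  have -> : pi_r (vdelta v) (edelta x w)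
      = if v == (w `\ x)%fset then edelta x w else (fun=> 0) :> (W -> C).
    have piE (e : W) : pi_r (vdelta v) (edelta x w) e
        = (((val (e : finsetEdge X)).2 `\ (val (e : finsetEdge X)).1)%fset == v)%:R
          * (val (e : finsetEdge X) == (x, w))%:R by [].
    case: ifPn => [/eqP ve|ne]; apply/funext => e; rewrite piE.
      by rewrite /edelta; have [->|_] := eqVneq (val (e : finsetEdge X)) (x, w);
         rewrite ?mulr0 //= ve eqxx mulr1.
    by have [->|_] := eqVneq (val (e : finsetEdge X)) (x, w);
       rewrite ?mulr0 //= eq_sym (negPf ne) mul0r.
  by case: ifP => // _; exact: pair_t1_0.
Qed.

Lemma C0_le (f g : V -> C) (c : R) : 0 < c -> C0 g ->
  (forall v, nrmc (f v) ^+ 2 <= c * nrmc (g v)) -> C0 f.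
Proof.
move=> c0 /C0P cg h; apply/C0P => eps eps0.
have e0 : 0 < eps ^+ 2 / c by rewrite divr_gt0 // exprn_gt0.
apply: sub_finite_set (cg _ e0) => v /= le; rewrite ler_pdivrMr // mulrC.
by apply: le_trans (h v); rewrite ler_pXn2r ?nnegrE // ?nrmc_ge0 // ltW.
Qed.

(* [u = - g + i sqrt (2 g - g^2)] satisfies [|1 + u| = 1], that is
   [|u|^2 = - 2 Re u], so the C*-identity bounds the norm of [t0 u] by 2. *)
Lemma pair_bound_unit (g : V -> C) : C0 g -> (forall v, 0 <= g v <= 1) ->
  nrm (t0 g) <= 2.
Proof.
(* [1 + u] is the unitary function with real part [1 - g], since [1 - (1 - g)^2 = 2 g - g^2]; unlike
   [1 + u], the function [u] always vanishes at infinity. *)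
move=> cg g01; pose u v : C := - g v + 'i%R * sqrtC (2 * g v - g v ^+ 2).
have gs v : 0 <= 2 * g v - g v ^+ 2.
  have /andP[g0 g1] := g01 v; rewrite expr2 -mulrBl mulr_ge0 // subr_ge0.
  by apply: le_trans g1 _; rewrite ler1n.
have conju v : (u v)^* = - g v - 'i%R * sqrtC (2 * g v - g v ^+ 2).
  rewrite /u rmorphD rmorphN rmorphM /= conjCi mulNr.
  have /andP[g0 _] := g01 v.
  by rewrite !(conj_Creal (ger0_real _)) // sqrtC_ge0.
have uu v : (u v)^* * u v = 2 * g v.
  rewrite conju /u; set r := sqrtC _; have rr : r ^+ 2 = 2 * g v - g v ^+ 2 by rewrite sqrtCK.
  transitivity (g v ^+ 2 - 'i%R ^+ 2 * r ^+ 2); first by ring.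
  by rewrite sqrCi rr; ring.
have upu v : u v + (u v)^* = - 2 * g v by rewrite conju /u; ring.
have u2 v : nrmc (u v) ^+ 2 = 2 * nrmc (g v).
  apply: (@complexI R); rewrite rmorphXn rmorphM /= -!nrmcE normCK mulrC uu.
  by rewrite ger0_norm ?rmorph_nat //; have /andP[] := g01 v.
have cu : C0 (u : V -> C) by apply: (@C0_le _ g 2) => // v; rewrite u2.
have cuc : C0 (fun v => (u v)^* : C).
  by apply: (@C0_le _ g 2) => // v; rewrite nrmcJ u2.
set U := t0 u; have adjU : cadj U = t0 (fun v => (u v)^*) by rewrite (T0_adj T cu).
have UU : cmul (cadj U) U = 2 *: t0 g.
  rewrite adjU -(T0_mul T cuc cu) -pair_t0Z //; congr t0; apply/funext => v.
  exact: uu.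
have UpU : U + cadj U = - (2 *: t0 g).
  rewrite adjU -(pair_t0D cu cuc) -scaleNr -pair_t0Z //; congr t0.
  by apply/funext => v; rewrite upu.
have n2 : nrmc (2 : C) = 2 by rewrite (_ : 2 = (2 : R)%:C%C) ?nrmcR ?ger0_norm // rmorph_nat.
have n2g : nrm (2 *: t0 g) = 2 * nrm (t0 g) by rewrite nrmZ n2.
have e1 : nrm U ^+ 2 = 2 * nrm (t0 g) by rewrite -nrm_adj_mul UU n2g.
have := nrmD U (cadj U); rewrite UpU nrmN n2g nrm_adj => le.
have U2 : nrm U <= 2.
  have [->|U0] := eqVneq (nrm U) 0; first by [].
  have Up : 0 < nrm U by rewrite lt0r U0 nrm_ge0.
  by rewrite -(ler_pM2l Up) -expr2 e1; lra.
lra.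
Qed.

Lemma pair_bound (g : V -> C) (c : R) : C0 g -> 0 < c ->
  (forall v, 0 <= g v <= c%:C%C) -> nrm (t0 g) <= 2 * c.
Proof.
move=> cg c0 g0c; have cC : 0 < c%:C%C :> C by rewrite ltcR.
pose g' v := (c%:C%C)^-1 * g v.
have cg' : C0 (g' : V -> C).
  apply/C0P => eps eps0; have /C0P/(_ (c * eps)) := cg; move/(_ (mulr_gt0 c0 eps0)).
  apply: sub_finite_set => v /=; rewrite nrmcM nrmcV nrmcR gtr0_norm //.
  by rewrite mulrC ler_pdivlMr // mulrC.
have := pair_bound_unit cg' => /(_ _)/wrap[] => [v|].
  have /andP[h0 h1] := g0c v; rewrite /g' mulr_ge0 ?invr_ge0 ?(ltW cC) //=.
  by rewrite mulrC ler_pdivrMr // mul1r.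
rewrite pair_t0Z // nrmZ nrmcV nrmcR gtr0_norm // mulrC ler_pdivrMr //.
Qed.

Lemma nrmc_sq (z : C) (c : R) : nrmc z <= c -> 0 <= z^* * z <= (c ^+ 2)%:C%C.
Proof.
move=> h; rewrite mulrC mul_conjC_ge0 -normCK nrmcE -rmorphXn lecR /=.
by rewrite ler_pXn2r ?nnegrE ?nrmc_ge0 // (le_trans _ h) // nrmc_ge0.
Qed.

(** The C*-identity reduces [f] to the nonnegative function [|f|^2], as it will reduce [t1 xi] to
    [t0 (inner xi xi)]. These bounds let finitely supported functions approximate in [A]. *)
Lemma pair_t0_bound (f : V -> C) (c : R) : C0 f -> 0 < c ->
  (forall v, nrmc (f v) <= c) -> nrm (t0 f) <= 2 * c.
Proof.
move=> cf c0 fc; have cfc : C0 (fun v => (f v)^* : C).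
  apply/C0P => eps eps0; have /C0P/(_ eps eps0) := cf.
  by apply: sub_finite_set => v /=; rewrite nrmcJ.
have cff : C0 (fun v => (f v)^* * f v).
  apply: (@C0_le _ f (c ^+ 3)) => //; first by rewrite exprn_gt0.
  move=> v; rewrite nrmcM nrmcJ; set n := nrmc _; have n0 : 0 <= n := nrmc_ge0 _.
  have -> : (n * n) ^+ 2 = n ^+ 3 * n by ring.
  by apply: ler_wpM2r => //; rewrite ler_pXn2r ?nnegrE ?(ltW c0) //; exact: fc.
have := pair_bound cff (exprn_gt0 2 c0) (fun v => nrmc_sq (fc v)).
rewrite (T0_mul T cfc cf) (T0_adj T cf) nrm_adj_mul => le.
rewrite -(ler_pXn2r (n := 2)) ?nnegrE ?nrm_ge0 ?mulr_ge0 ?(ltW c0) //.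
apply: le_trans le _; rewrite exprMn ler_wpM2r ?exprn_ge0 ?(ltW c0) //; lra.
Qed.

Lemma pair_t1_bound (xi : W -> C) (c : R) : Cd (finsetGraph X) xi -> 0 < c ->
  (forall v, nrmc (inner xi xi v) <= c ^+ 2) -> nrm (t1 xi) <= 2 * c.
Proof.
move=> cxi c0 xic; have cx := cxi; move/CdP: cx => cx.
have := pair_bound cx (exprn_gt0 2 c0).
rewrite -(T1_inner T cxi cxi) nrm_adj_mul => /(_ _)/wrap[] => [v|le].
  rewrite inner_ge0 /= -[leLHS]ger0_norm ?inner_ge0 // nrmcE lecR //.
rewrite -(ler_pXn2r (n := 2)) ?nnegrE ?nrm_ge0 ?mulr_ge0 ?(ltW c0) //.
apply: le_trans le _; rewrite exprMn ler_wpM2r ?exprn_ge0 ?(ltW c0) //; lra.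
Qed.

Lemma t0_finite_dsub (f : V -> C) (r : seq {fset X}) : uniq r ->
  dsub p s (t0 (fun v => if (v : {fset X}) \in r then f v else 0)).
Proof.
elim: r => [_|v r IH /= /andP[vr ur]].
  by rewrite (_ : (fun=> _) = fun=> 0) // pair_t0_0; exact: lin0.
have -> : (fun u : V => if (u : {fset X}) \in v :: r then f u else 0)
    = (fun u => f v * vdelta v u + if (u : {fset X}) \in r then f u else 0).
  apply/funext => u; rewrite in_cons /vdelta.
  by case: eqVneq => [->|_] /=; rewrite ?(negPf vr) ?mulr1 ?addr0 ?mulr0 ?add0r.
rewrite (T0_linear T); [|exact: C0_vdelta|].
  apply: linS; last exact: IH.
  exists [::], v, [::]; split=> //.
  by rewrite /gen /= (family_adj pair_family) (family_proj pair_family) eqxx.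
apply: (@finitely_supported_C0 _ _ _ [fset u in r]%fset) => u.
by rewrite inE => /negPf ->.
Qed.

Lemma t1_finite_dsub (xi : W -> C) (r : seq (finsetEdge X)) : uniq r ->
  dsub p s (t1 (fun e => if (e : finsetEdge X) \in r then xi e else 0)).
Proof.
elim: r => [_|e r IH /= /andP[er ur]].
  by rewrite (_ : (fun=> _) = fun=> 0) // pair_t1_0; exact: lin0.
have -> : (fun u : W => if (u : finsetEdge X) \in e :: r then xi u else 0)
    = (fun u => xi e * edelta (val e).1 (val e).2 u + if (u : finsetEdge X) \in r then xi u else 0).
  apply/funext => u; rewrite in_cons /edelta -surjective_pairing (inj_eq val_inj).
  by case: eqVneq => [->|_] /=; rewrite ?(negPf er) ?mulr1 ?addr0 ?mulr0 ?add0r.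
rewrite (T1_linear T); [|exact: Cd_edelta|].
  apply: linS; last exact: IH.
  exists [:: (val e).1], (val e).2, [::]; split=> //.
  rewrite /gen (family_adj pair_family) /= -cmulA (family_dom pair_family) eqxx.
  by rewrite (family_rng pair_family) eqxx.
apply: (@finitely_supported_Cd _ _ _ [fset (val u).2 | u in r]%fset) => u ur'.
by case: ifP => // h; case/negP: ur'; apply/imfsetP; exists u.
Qed.

Lemma t0_approximable (f : V -> C) : C0 f -> approximable (dsub p s) (t0 f).
Proof.
(* A tail bounded by [e / 3] has image of norm at most [2 e / 3 < e] by [pair_t0_bound]. *)
move=> cf e e0; have e3 : 0 < e / 3 by rewrite divr_gt0.
have /C0P/(_ _ e3) fin := cf; set S := [set x | _] in fin.
pose f1 (v : V) : C := if (v : {fset X}) \in fset_set S then f v else 0.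
pose f2 (v : V) : C := if (v : {fset X}) \in fset_set S then 0 else f v.
exists (t0 f1); split; first by apply: t0_finite_dsub; exact: fset_uniq.
have cf1 : C0 f1.
  by apply: (@finitely_supported_C0 _ _ _ (fset_set S)) => u; rewrite /f1 => /negPf ->.
have cf2 : C0 f2.
  apply/C0P => eps eps0; have /C0P/(_ _ eps0) := cf; apply: sub_finite_set => v /=.
  by rewrite /f2; case: ifP => // _; rewrite /nrmc normr0 /=; lra.
have -> : t0 f = t0 f1 + t0 f2.
  rewrite -pair_t0D //; congr t0; apply/funext => v; rewrite /f1 /f2.
  by case: ifP; rewrite ?addr0 ?add0r.
rewrite addrAC subrr add0r.
have := pair_t0_bound cf2 e3; move=> /(_ _)/wrap[] => [v|]; last by lra.
rewrite /f2; case: ifPn => [_|]; first by rewrite /nrmc normr0 /=; lra.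
rewrite in_fset_set // => /negP; rewrite inE /S /= => /negP; rewrite -ltNge => /ltW.
by [].
Qed.

(** The cut is made by sources: [inner xi xi] is at least [(e / 3)^2] at finitely many vertices,
    each of which emits finitely many edges, and the inner square of the tail is the restriction of
    [inner xi xi] to the other vertices. *)
Lemma t1_approximable (xi : W -> C) : Cd (finsetGraph X) xi -> approximable (dsub p s) (t1 xi).
Proof.
move=> cxi e e0; have e3 : 0 < e / 3 by rewrite divr_gt0.
have cx := cxi; move/CdP/C0P: cx => /(_ _ (exprn_gt0 2 e3)) fin.
set S := [set x | _] in fin.
pose FS : seq {fset X} := enum_fset (fset_set S).
pose r : seq (finsetEdge X) :=
  undup (pmap (insub : X * {fset X} -> option (finsetEdge X)) (members FS)).
have rE (u : finsetEdge X) : (u \in r) = ((val u).2 \in fset_set S).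
  by rewrite mem_undup mem_pmap_sub; exact: mem_members (valP u).
pose x1 (u : W) : C := if (u : finsetEdge X) \in r then xi u else 0.
pose x2 (u : W) : C := if (u : finsetEdge X) \in r then 0 else xi u.
exists (t1 x1); split; first by apply: t1_finite_dsub; exact: undup_uniq.
have cx1 : Cd (finsetGraph X) x1.
  by apply: (@finitely_supported_Cd _ _ _ (fset_set S)) => u; rewrite /x1 rE => /negPf ->.
have in2 v : inner x2 x2 v = if (v : {fset X}) \in fset_set S then 0 else inner xi xi v.
  rewrite !innerE; case: ifPn => vS.
    rewrite big_seq big1 // => x xv; rewrite !(edge_val_in _ xv) /x2 rE /= vS.
    by rewrite mulr0.
  rewrite big_seq [RHS]big_seq; apply: eq_bigr => x xv.
  by rewrite !(edge_val_in _ xv) /x2 rE /= (negPf vS).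
have cx2 : Cd (finsetGraph X) x2.
  apply/CdP/C0P => eps eps0; move/CdP/C0P: cxi => /(_ _ eps0).
  apply: sub_finite_set => v /=; rewrite in2; case: ifP => // _.
  by rewrite /nrmc normr0 /=; lra.
have -> : t1 xi = t1 x1 + t1 x2.
  have := T1_linear T 1 cx1 cx2; rewrite scale1r => <-; congr t1; apply/funext => u.
  by rewrite mul1r /x1 /x2; case: ifP; rewrite ?addr0 ?add0r.
rewrite addrAC subrr add0r.
have := pair_t1_bound cx2 e3; move=> /(_ _)/wrap[] => [v|]; last by lra.
rewrite in2; case: ifPn => [_|]; first by rewrite /nrmc normr0 /= exprn_ge0 // ltW.
by rewrite in_fset_set // => /negP; rewrite inE /S /= => /negP; rewrite -ltNge => /ltW.
Qed.

Lemma pair_dense : cstar_generated (t0 @` C0 `|` t1 @` Cd (finsetGraph X)) ->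
  forall a, approximable (dsub p s) a.
Proof.
move=> gen; apply: (generated_dense _ _ _ _ gen).
- exact: lin0.
- by move=> z a b; exact: lin_linear.
- by move=> a b; exact: (lin_gens_mul pair_family).
- by move=> a; exact: lin_gens_adj.
- by move=> _ [[f cf <-]|[xi cxi <-]]; [exact: t0_approximable|exact: t1_approximable].
Qed.

End ToeplitzPair.

(** * The C*-algebra of complex matrices *)

Section EuclideanNorm.
Context {R : realType}.
Local Notation C := R[i].

Lemma cauchy_schwarz_sum (I : finType) (a b : I -> R) :
  (\sum_i a i * b i) ^+ 2 <= (\sum_i a i ^+ 2) * (\sum_i b i ^+ 2).
Proof.
set S := \sum_i a i * b i; set P := \sum_i a i ^+ 2; set Q := \sum_i b i ^+ 2.
have Q0 : 0 <= Q by apply: sumr_ge0 => i _; exact: sqr_ge0.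
(* The squared distance from [a] to its projection on the line of [b], cleared of the denominator
   [Q]. *)
have : 0 <= \sum_i (Q * a i - S * b i) ^+ 2 by apply: sumr_ge0 => i _; exact: sqr_ge0.
have -> : \sum_i (Q * a i - S * b i) ^+ 2 = Q * (P * Q - S ^+ 2).
  transitivity (\sum_i (Q ^+ 2 * a i ^+ 2 - 2 * Q * S * (a i * b i) + S ^+ 2 * b i ^+ 2)).
    by apply: eq_bigr => i _; ring.
  by rewrite big_split sumrB /= -!mulr_sumr -/S -/P -/Q; ring.
move: Q0; rewrite le_eqVlt => /orP[/eqP Q0 _|Qp]; last by rewrite pmulr_rge0 // subr_ge0.
have b0 i : b i = 0.
  apply/eqP; rewrite -sqrf_eq0; apply/eqP.
  have /psumr_eq0P := esym Q0; apply=> // j _; exact: sqr_ge0.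
by rewrite /S big1 ?expr0n /= ?mulr_ge0 ?sumr_ge0 // => [i _|i _|i _]; rewrite ?b0 ?mulr0 ?sqr_ge0.
Qed.

Definition sqn n (x : 'cV[C]_n) : R := \sum_i nrmc (x i 0) ^+ 2.
Definition enorm n (x : 'cV[C]_n) : R := Num.sqrt (sqn x).

Lemma sqn_ge0 n (x : 'cV[C]_n) : 0 <= sqn x.
Proof. by apply: sumr_ge0 => i _; exact: sqr_ge0. Qed.

Lemma enorm_ge0 n (x : 'cV[C]_n) : 0 <= enorm x.
Proof. exact: sqrtr_ge0. Qed.

Lemma enorm_sqr n (x : 'cV[C]_n) : enorm x ^+ 2 = sqn x.
Proof. by rewrite sqr_sqrtr // sqn_ge0. Qed.

Lemma nrmcD (z t : C) : nrmc (z + t) <= nrmc z + nrmc t.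
Proof. by rewrite -(@lecR R) rmorphD /= -!nrmcE ler_normD. Qed.

Lemma nrmc0 : nrmc (0 : C) = 0.
Proof. by rewrite /nrmc normr0. Qed.

Lemma nrmc_i : nrmc ('i%C : C) = 1.
Proof. by rewrite /nrmc normc_def /= expr0n expr1n add0r sqrtr1. Qed.

Lemma nrmc_sum (I : Type) (r : seq I) (P : pred I) (F : I -> C) :
  nrmc (\sum_(i <- r | P i) F i) <= \sum_(i <- r | P i) nrmc (F i).
Proof.
elim/big_ind2 : _ => [|x1 x2 y1 y2 h1 h2|//]; first by rewrite nrmc0.
by rewrite (le_trans (nrmcD _ _))// lerD.
Qed.

Lemma cauchy_schwarz n (x y : 'cV[C]_n) :
  \sum_i nrmc (x i 0) * nrmc (y i 0) <= enorm x * enorm y.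
Proof.
have s0 : 0 <= \sum_i nrmc (x i 0) * nrmc (y i 0).
  by apply: sumr_ge0 => i _; rewrite mulr_ge0 ?nrmc_ge0.
rewrite -(ler_pXn2r (n := 2)) ?nnegrE ?mulr_ge0 ?enorm_ge0 //.
by rewrite exprMn !enorm_sqr; exact: cauchy_schwarz_sum.
Qed.

Lemma enormD n (x y : 'cV[C]_n) : enorm (x + y) <= enorm x + enorm y.
Proof.
rewrite -(ler_pXn2r (n := 2)) ?nnegrE ?addr_ge0 ?enorm_ge0 // sqrrD !enorm_sqr.
apply: (@le_trans _ _ (\sum_i (nrmc (x i 0) + nrmc (y i 0)) ^+ 2)).
  apply: ler_sum => i _; rewrite ler_pXn2r ?nnegrE ?addr_ge0 ?nrmc_ge0 // mxE.
  exact: nrmcD.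
rewrite (eq_bigr (fun i => nrmc (x i 0) ^+ 2 + 2 * (nrmc (x i 0) * nrmc (y i 0))
    + nrmc (y i 0) ^+ 2)); last by move=> i _; ring.
rewrite !big_split /= -mulr_sumr lerD2r lerD2l -[leRHS]mulr_natl ler_pM2l //.
exact: cauchy_schwarz.
Qed.

Lemma enormZ n (z : C) (x : 'cV[C]_n) : enorm (z *: x) = nrmc z * enorm x.
Proof.
rewrite /enorm -[nrmc z in RHS]ger0_norm ?nrmc_ge0 // -sqrtr_sqr -sqrtrM ?sqr_ge0 //.
by congr Num.sqrt; rewrite mulr_sumr; apply: eq_bigr => i _; rewrite mxE nrmcM exprMn.
Qed.

Lemma enorm0 n : enorm (0 : 'cV[C]_n) = 0.
Proof. by rewrite -(scale0r 0) enormZ nrmc0 mul0r. Qed.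

Lemma enorm_coord n (x : 'cV[C]_n) i : nrmc (x i 0) <= enorm x.
Proof.
rewrite -(ler_pXn2r (n := 2)) ?nnegrE ?nrmc_ge0 ?enorm_ge0 // enorm_sqr.
by rewrite /sqn (bigD1 i) //= lerDl sumr_ge0 // => j _; exact: sqr_ge0.
Qed.

Lemma enorm_eq0 n (x : 'cV[C]_n) : enorm x = 0 -> x = 0.
Proof.
move=> e; apply/matrixP => i j; rewrite ord1 mxE; apply/eqP.
apply: contraT; rewrite -nrmc_gt0 => lt.
by have := lt_le_trans lt (enorm_coord x i); rewrite e ltxx.
Qed.

Lemma enorm_le_sum n (x : 'cV[C]_n) : enorm x <= \sum_i nrmc (x i 0).
Proof.
have s0 (r : seq 'I_n) : 0 <= \sum_(i <- r) nrmc (x i 0).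
  by apply: sumr_ge0 => i _; exact: nrmc_ge0.
rewrite -(ler_pXn2r (n := 2)) ?nnegrE ?enorm_ge0 // enorm_sqr /sqn.
elim: (index_enum _) => [|i r IH]; first by rewrite !big_nil expr0n.
rewrite !big_cons sqrrD -addrA lerD2l (le_trans IH) // lerDr mulrn_wge0 //.
by rewrite mulr_ge0 ?nrmc_ge0.
Qed.

Lemma enorm_delta n (i : 'I_n) : enorm (delta_mx i 0) = 1.
Proof.
rewrite /enorm /sqn (bigD1 i) //= big1 => [|j /negPf ji].
  by rewrite mxE !eqxx addr0 (_ : true%:R = (1 : R)%:C%C) // nrmcR normr1 expr1n sqrtr1.
by rewrite mxE ji nrmc0 expr0n.
Qed.

End EuclideanNorm.

Section OperatorNorm.
Context {R : realType} {n : nat}.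
Local Notation C := R[i].
Implicit Types (a b : 'M[C]_n) (x y : 'cV[C]_n).

Definition opn a : R := sup [set r | exists2 x, enorm x <= 1 & r = enorm (a *m x)].

(** A crude upper bound for the operator norm: it makes the supremum finite and turns entrywise
    convergence into norm convergence. *)
Definition entry_sum a : R := \sum_i \sum_j nrmc (a i j).

Lemma entry_sum_bound a x : enorm (a *m x) <= entry_sum a * enorm x.
Proof.
apply: le_trans (enorm_le_sum _) _; rewrite mulr_suml; apply: ler_sum => i _.
rewrite mxE mulr_suml; apply: le_trans (nrmc_sum _ _ _) _; apply: ler_sum => j _.
by rewrite nrmcM ler_wpM2l ?nrmc_ge0 // enorm_coord.
Qed.

Lemma entry_sum_ge0 a : 0 <= entry_sum a.
Proof. by apply: sumr_ge0 => i _; apply: sumr_ge0 => j _; exact: nrmc_ge0. Qed.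

Lemma opn_has_sup a : has_sup [set r | exists2 x, enorm x <= 1 & r = enorm (a *m x)].
Proof.
split; first by exists (enorm (a *m 0)); exists 0; rewrite ?enorm0.
exists (entry_sum a) => _ [x x1 ->]; apply: le_trans (entry_sum_bound a x) _.
by rewrite ler_piMr ?entry_sum_ge0.
Qed.

Lemma opn_ge0 a : 0 <= opn a.
Proof.
apply: (ub_le_sup (opn_has_sup a).2); exists 0; rewrite ?enorm0 ?mulmx0 ?enorm0 //.
Qed.

Lemma opn_bound a x : enorm (a *m x) <= opn a * enorm x.
Proof.
have [/enorm_eq0 ->|x0] := eqVneq (enorm x) 0; first by rewrite mulmx0 !enorm0 mulr0.
have xp : 0 < enorm x by rewrite lt0r x0 enorm_ge0.
rewrite -ler_pdivrMr // mulrC -[X in X * _]gtr0_norm ?invr_gt0 //.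
rewrite -nrmcR -enormZ scalemxAr; apply: (ub_le_sup (opn_has_sup a).2).
exists (((enorm x)^-1)%:C%C *: x) => //.
by rewrite enormZ nrmcR gtr0_norm ?invr_gt0 // mulVf.
Qed.

Lemma opn_le a (c : R) : 0 <= c -> (forall x, enorm (a *m x) <= c * enorm x) -> opn a <= c.
Proof.
move=> c0 h; apply: ge_sup; first exact: (opn_has_sup a).1.
by move=> _ [x x1 ->]; apply: le_trans (h x) _; rewrite ler_piMr.
Qed.

Lemma opn_le_entry_sum a : opn a <= entry_sum a.
Proof. by apply: opn_le; [exact: entry_sum_ge0|exact: entry_sum_bound]. Qed.

Lemma entry_le_opn a i j : nrmc (a i j) <= opn a.
Proof.
have := opn_bound a (delta_mx j 0); rewrite enorm_delta mulr1; apply: le_trans.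
by have := enorm_coord (a *m delta_mx j 0) i; rewrite -colE mxE.
Qed.

Lemma opnD a b : opn (a + b) <= opn a + opn b.
Proof.
apply: opn_le => [|x]; first by rewrite addr_ge0 ?opn_ge0.
by rewrite mulmxDl mulrDl (le_trans (enormD _ _)) // lerD // opn_bound.
Qed.

Lemma opnM a b : opn (a *m b) <= opn a * opn b.
Proof.
apply: opn_le => [|x]; first by rewrite mulr_ge0 ?opn_ge0.
rewrite -mulmxA -mulrA (le_trans (opn_bound _ _)) // ler_wpM2l ?opn_ge0 //.
exact: opn_bound.
Qed.

Lemma opnZ_le z a : opn (z *: a) <= nrmc z * opn a.
Proof.
apply: opn_le => [|x]; first by rewrite mulr_ge0 ?opn_ge0 ?nrmc_ge0.
by rewrite -scalemxAl enormZ -mulrA ler_wpM2l ?nrmc_ge0 // opn_bound.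
Qed.

Lemma opn_eq0 a : opn a = 0 -> a = 0.
Proof.
move=> e; apply/matrixP => i j; rewrite mxE; apply/eqP.
apply: contraT; rewrite -nrmc_gt0 => lt.
by have := lt_le_trans lt (entry_le_opn a i j); rewrite e ltxx.
Qed.

Lemma opnZ z a : opn (z *: a) = nrmc z * opn a.
Proof.
have [->|z0] := eqVneq z 0.
  rewrite scale0r nrmc0 mul0r; apply/le_anti; rewrite opn_ge0 andbT.
  by apply: opn_le => // x; rewrite mul0mx enorm0 mul0r.
apply/le_anti; rewrite opnZ_le /=.
have zp : 0 < nrmc z by rewrite nrmc_gt0.
have aE : a = z^-1 *: (z *: a) by rewrite scalerA (mulVf z0) scale1r.
rewrite mulrC -ler_pdivlMr // mulrC -nrmcV {1}aE.
exact: opnZ_le.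
Qed.

Definition adjmx m k (a : 'M[C]_(m, k)) : 'M[C]_(k, m) := (map_mx Num.conj a)^T.

Lemma adjmxK m k (a : 'M[C]_(m, k)) : adjmx (adjmx a) = a.
Proof. by apply/matrixP => i j; rewrite !mxE conjCK. Qed.

Lemma adjmxM m k l (a : 'M[C]_(m, k)) (b : 'M[C]_(k, l)) :
  adjmx (a *m b) = adjmx b *m adjmx a.
Proof. by rewrite /adjmx map_mxM trmx_mul. Qed.

Lemma adjmx_antilinear m k z (a b : 'M[C]_(m, k)) :
  adjmx (z *: a + b) = z^* *: adjmx a + adjmx b.
Proof. by apply/matrixP => i j; rewrite !mxE rmorphD rmorphM. Qed.

Lemma sqn_dot x : (sqn x)%:C%C = (adjmx x *m x) 0 0.
Proof.
rewrite mxE rmorph_sum; apply: eq_bigr => i _.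
by rewrite !mxE rmorphXn /= -nrmcE normCKC.
Qed.

Lemma dot_le x y : nrmc ((adjmx x *m y) 0 0) <= enorm x * enorm y.
Proof.
rewrite mxE (le_trans (nrmc_sum _ _ _)) //; apply: le_trans (cauchy_schwarz x y).
by apply: ler_sum => i _; rewrite !mxE nrmcM nrmcJ.
Qed.

Lemma opn_sqr_le a : opn a ^+ 2 <= opn (adjmx a *m a).
Proof.
set c := opn (adjmx a *m a); have c0 : 0 <= c := opn_ge0 _.
rewrite -(sqr_sqrtr c0) ler_pXn2r ?nnegrE ?opn_ge0 ?sqrtr_ge0 //.
apply: opn_le => [|x]; first exact: sqrtr_ge0.
rewrite -(ler_pXn2r (n := 2)) ?nnegrE ?mulr_ge0 ?sqrtr_ge0 ?enorm_ge0 //.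
rewrite exprMn (sqr_sqrtr c0) enorm_sqr -[sqn _]ger0_norm ?sqn_ge0 //.
rewrite -nrmcR sqn_dot adjmxM -mulmxA (le_trans (dot_le _ _)) //.
rewrite mulrC expr2 mulrA ler_wpM2r ?enorm_ge0 //.
by rewrite mulmxA; exact: opn_bound.
Qed.

Lemma opn_adj_le a : opn a <= opn (adjmx a).
Proof.
have [->|a0] := eqVneq (opn a) 0; first exact: opn_ge0.
have ap : 0 < opn a by rewrite lt0r a0 opn_ge0.
rewrite -(ler_pM2r ap) -[leLHS]expr2; apply: le_trans (opn_sqr_le a) _.
exact: opnM.
Qed.

Lemma opn_adj a : opn (adjmx a) = opn a.
Proof.
apply/le_anti/andP; split; last exact: opn_adj_le.
by have := opn_adj_le (adjmx a); rewrite adjmxK.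
Qed.

Lemma opn_cstar a : opn (adjmx a *m a) = opn a ^+ 2.
Proof.
apply/le_anti/andP; split; last exact: opn_sqr_le.
by rewrite expr2 -[X in _ <= X * _]opn_adj; exact: opnM.
Qed.

End OperatorNorm.

(** A separate name, so that the operator norm does not clash with the entrywise structures on
    matrices. *)
Definition opmx (R : realType) (n : nat) : Type := 'M[R[i]]_n.

Section MatrixAlgebra.
Context (R : realType) (n : nat).
Local Notation C := R[i].
Local Notation M := (opmx R n).

HB.instance Definition _ := GRing.Lmodule.copy M 'M[C]_n.

Definition opmx_norm (a : M) : C := (opn a)%:C%C.

Lemma opmx_normD (a b : M) : opmx_norm (a + b) <= opmx_norm a + opmx_norm b.
Proof. by rewrite /opmx_norm -rmorphD lecR opnD. Qed.

Lemma opmx_normZ (z : C) (a : M) : opmx_norm (z *: a) = `|z| * opmx_norm a.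
Proof. by rewrite /opmx_norm nrmcE -rmorphM; congr (_%:C%C); exact: opnZ. Qed.

Lemma opmx_norm0_eq0 (a : M) : opmx_norm a = 0 -> a = 0.
Proof. by move=> /(@complexI R)/opn_eq0. Qed.

HB.instance Definition _ :=
  @Lmodule_isNormed.Build C M opmx_norm opmx_normD opmx_normZ opmx_norm0_eq0.

(** Real and imaginary parts of the entries are dominated by the operator norm, so they converge in
    [R]; [entry_sum] then controls the distance to the matrix of limits. *)
Lemma opmx_complete (F : set_system M) : ProperFilter F -> cauchy F -> cvg F.
Proof.
move=> FF cF.
have cauchyR (g : M -> R) : (forall a b : M, `|g a - g b| <= opn (a - b)) ->
    exists l : R, forall e : R, 0 < e -> \forall a \near F, `|l - g a| < e.
  move=> gle; have cg : cauchy (g @ F).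
    apply: cauchy_exP => e e0; have ec : 0 < e%:C%C :> C by rewrite ltcR.
    have /cauchyP/(_ _ ec)[a Fa] := cF.
    exists (g a); have sub : ball a e%:C%C `<=` g @^-1` ball (g a) e.
      move=> b; rewrite -!ball_normE /= => lt.
      by apply: le_lt_trans (gle a b) _; rewrite -ltcR.
    exact: (filterS sub Fa).
  have /cvg_ex[l gl] : cvg (g @ F) by apply: cauchy_cvg.
  exists l => e e0.
  by have /cvgrPdist_lt/(_ _ e0) := gl.
have Re_le (z : C) : `|complex.Re z| <= nrmc z by rewrite -lecR -nrmcE normc_ge_Re.
have Im_le (z : C) : `|complex.Im z| <= nrmc z.
  by have := Re_le (z * 'i%C); rewrite ReiNIm normrN nrmcM nrmc_i mulr1.
have entB (a b : M) i j : a i j - b i j = (a - b) i j by rewrite !mxE.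
have reP i j : exists l : R, forall e : R, 0 < e ->
    \forall a \near F, `|l - complex.Re ((a : M) i j)| < e.
  apply: cauchyR => a b; rewrite -raddfB entB; apply: le_trans (Re_le _) _.
  exact: entry_le_opn.
have imP i j : exists l : R, forall e : R, 0 < e ->
    \forall a \near F, `|l - complex.Im ((a : M) i j)| < e.
  apply: cauchyR => a b; rewrite -raddfB entB; apply: le_trans (Im_le _) _.
  exact: entry_le_opn.
have /choice[re reE] : forall ij : 'I_n * 'I_n, exists l : R, forall e : R, 0 < e ->
    \forall a \near F, `|l - complex.Re ((a : M) ij.1 ij.2)| < e by move=> ij; exact: reP.
have /choice[im imE] : forall ij : 'I_n * 'I_n, exists l : R, forall e : R, 0 < e ->
    \forall a \near F, `|l - complex.Im ((a : M) ij.1 ij.2)| < e by move=> ij; exact: imP.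
pose L : M := \matrix_(i, j) Complex (re (i, j)) (im (i, j)).
apply/cvg_ex; exists L; apply/cvgrPdist_lt => eps eps0.
have epsE : eps = (complex.Re eps)%:C%C by rewrite RRe_real // gtr0_real.
set e := complex.Re eps in epsE; have e0 : 0 < e by rewrite -(@ltcR R) -epsE.
(* There are [n^2] entries, each off by at most [2 d]; the added 1 makes the estimate strict and
   covers [n = 0]. *)
pose d := e / (2 * n%:R * n%:R + 1).
have k0 : 0 < 2 * n%:R * n%:R + 1 :> R by rewrite ltr_wpDl // !mulr_ge0.
have d0 : 0 < d by rewrite divr_gt0.
have Hre : \forall a \near F, forall ij : 'I_n * 'I_n,
    `|re ij - complex.Re ((a : M) ij.1 ij.2)| < d.
  by apply: filter_forall => ij; exact: reE.
have Him : \forall a \near F, forall ij : 'I_n * 'I_n,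
    `|im ij - complex.Im ((a : M) ij.1 ij.2)| < d.
  by apply: filter_forall => ij; exact: imE.
near=> a; rewrite epsE -[ltLHS]/((opn (L - a))%:C%C) ltcR.
apply: le_lt_trans (opn_le_entry_sum _) _.
have ent i j : nrmc ((L - a) i j) <= 2 * d.
  have : nrmc ((L - a) i j) <= `|complex.Re ((L - a) i j)| + `|complex.Im ((L - a) i j)|.
    rewrite {1}[(L - a) i j]complexE (le_trans (nrmcD _ _)) // nrmcM !nrmcR.
    by rewrite nrmc_i mul1r.
  have : forall ij : 'I_n * 'I_n, `|re ij - complex.Re (a ij.1 ij.2)| < d by near: a.
  have : forall ij : 'I_n * 'I_n, `|im ij - complex.Im (a ij.1 ij.2)| < d by near: a.
  move=> /(_ (i, j)) /= h1 /(_ (i, j)) /= h2.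
  rewrite -entB !raddfB mxE /=; lra.
apply: (@le_lt_trans _ _ (\sum_(i < n) \sum_(j < n) 2 * d)).
  by apply: ler_sum => i _; apply: ler_sum => j _; exact: ent.
rewrite !sumr_const !card_ord -[_ *+ n *+ n]mulr_natr -[2 * d *+ n]mulr_natr.
have -> : 2 * d * n%:R * n%:R = e * ((2 * n%:R * n%:R) / (2 * n%:R * n%:R + 1)).
  by rewrite /d; set k := _^-1; ring.
by rewrite gtr_pMr // ltr_pdivrMr // mul1r ltrDl.
Unshelve. all: by end_near. Qed.

HB.instance Definition _ := Uniform_isComplete.Build M opmx_complete.

Lemma opmx_mulDl (z : C) (a b c : M) :
  (z *: a + b : M) *m c = z *: (a *m c) + b *m c :> M.
Proof. by rewrite mulmxDl -scalemxAl. Qed.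

Lemma opmx_mulDr (z : C) (a b c : M) :
  a *m (z *: b + c : M) = z *: (a *m b) + a *m c :> M.
Proof. by rewrite mulmxDr -scalemxAr. Qed.

Lemma opmx_norm_mul (a b : M) : `|(a *m b : M)| <= `|a| * `|b|.
Proof. by rewrite -[ `|a| * _ ]rmorphM lecR opnM. Qed.

Lemma opmx_cstar (a : M) : `|(adjmx a *m a : M)| = `|a| ^+ 2.
Proof. by rewrite -[ `|a| ]/((opn a)%:C%C) -rmorphXn -opn_cstar. Qed.

Definition opmx_algebra : cstarAlgebra R :=
  @CstarAlgebra R M (fun a b : 'M[C]_n => a *m b) (fun a => adjmx a)
    (fun a b c => mulmxA a b c) opmx_mulDl opmx_mulDr
    (fun a => adjmxK a) (fun z a b => adjmx_antilinear z a b)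
    (fun a b => adjmxM a b) opmx_norm_mul opmx_cstar.

End MatrixAlgebra.

(** * The path representation *)

(* The finitely many paths with source [w0] index the basis; [t0 f] multiplies a
   path by the value of [f] at its range and [t1 xi] prepends edges. *)
Section PathModel.
Context (R : realType) (X : choiceType) (w0 : {fset X}).
Local Notation C := R[i].
Local Notation V := (vertex (finsetGraph X)).
Local Notation W := (edge (finsetGraph X)).

Definition paths : seq (seq X) := undup [seq l <- words (enum_fset w0) #|` w0| | ok l w0].

Lemma mem_paths l : (l \in paths) = ok l w0.
Proof. by rewrite mem_undup mem_filter andb_idr // => /ok_words. Qed.

Local Notation n := (size paths).
Definition path_at (i : 'I_n) : seq X := nth [::] paths i.
Definition vertex_at (i : 'I_n) : {fset X} := rng w0 (path_at i).

Lemma path_at_ok i : ok (path_at i) w0.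
Proof. by rewrite -mem_paths mem_nth. Qed.

Lemma path_at_inj : injective path_at.
Proof. by move=> i j /eqP; rewrite nth_uniq ?undup_uniq // => /eqP/val_inj. Qed.

Lemma path_atP l : ok l w0 -> exists i, path_at i = l.
Proof.
rewrite -mem_paths => lP; have il : (index l paths < n)%N by rewrite index_mem.
by exists (Ordinal il); rewrite /path_at /= nth_index.
Qed.

Lemma ok_cat l m (w : {fset X}) : ok (l ++ m) w = ok l w && ok m (rng w l).
Proof. by elim: l w => //= x l IH w; rewrite IH andbA. Qed.

Definition model_t0 (f : V -> C) : opmx R n :=
  \matrix_(i, j) (f (vertex_at i) *+ (i == j)).

(** A path grows at its range, which is the end of the list, hence [rcons]. *)
Definition model_t1 (xi : W -> C) : opmx R n :=
  \matrix_(i, j) \sum_(x <- vertex_at j)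
    edge_val xi x (vertex_at j) *+ (path_at i == rcons (path_at j) x).

Lemma rng_rcons (w : {fset X}) l x : rng w (rcons l x) = (rng w l `\ x)%fset.
Proof. by rewrite -cats1 rng_cat. Qed.

Lemma edge_val_pi_r f (xi : W -> C) x (v : {fset X}) :
  edge_val (pi_r f xi) x v = f (v `\ x)%fset * edge_val xi x v.
Proof.
have [xv|xv] := boolP (x \in v); last by rewrite !edge_val_out // mulr0.
by rewrite !(edge_val_in _ xv).
Qed.

Lemma edge_val_linear z (xi eta : W -> C) x (v : {fset X}) :
  edge_val (fun e => z * xi e + eta e) x v = z * edge_val xi x v + edge_val eta x v.
Proof.
have [xv|xv] := boolP (x \in v); last by rewrite !edge_val_out // mulr0 addr0.
by rewrite !(edge_val_in _ xv).
Qed.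

Lemma model_toeplitz :
  @toeplitz_pair R (finsetGraph X) (opmx_algebra R n) model_t0 model_t1.
Proof.
split=> [z f g _ _|f g _ _|f _|z xi eta _ _|xi eta _ _|f xi _ _].
- apply/matrixP => i j; rewrite !mxE mulrnDl mulrnAr; congr (_ + _).
- apply/matrixP => i j; rewrite !mxE (bigD1 i) //= big1 ?addr0.
    by rewrite !mxE eqxx mulr1n mulrnAr.
  by move=> k /negPf ki; rewrite !mxE eq_sym ki mulr0n mul0r.
- apply/matrixP => i j; rewrite !mxE rmorphMn eq_sym.
  by case: eqVneq => [->|]; rewrite ?mulr0n.
- apply/matrixP => i j; rewrite !mxE mulr_sumr -big_split /=; apply: eq_bigr => x _.
  by rewrite edge_val_linear mulrnDl mulrnAr.
- apply/matrixP => j k; rewrite !mxE innerE.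
  transitivity (\sum_(i < n) \sum_(x <- vertex_at j) \sum_(y <- vertex_at k)
      ((edge_val xi x (vertex_at j))^* * edge_val eta y (vertex_at k))
        *+ ((path_at i == rcons (path_at j) x) && (path_at i == rcons (path_at k) y))).
    apply: eq_bigr => i _; rewrite !mxE rmorph_sum mulr_suml; apply: eq_bigr => x _.
    rewrite mulr_sumr; apply: eq_bigr => y _.
    rewrite rmorphMn mulrnAl mulrnAr -mulrnA mulnb andbC; congr (_ *+ _).
  rewrite exchange_big /= (eq_bigr (fun x => \sum_(y <- vertex_at k)
      ((edge_val xi x (vertex_at j))^* * edge_val eta y (vertex_at k))
        *+ ((j == k) && (x == y)))).
    case: (eqVneq j k) => [->|jk] /=; last first.
      by rewrite mulr0n big1 // => x _; rewrite big1.
    rewrite mulr1n; rewrite big_seq [RHS]big_seq; apply: eq_bigr => x xv.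
    rewrite (bigD1_seq x) ?fset_uniq //= eqxx mulr1n big1 ?addr0 // => y.
    by rewrite eq_sym => /negPf ->.
  move=> x xj; rewrite exchange_big /=; apply: eq_bigr => y _.
  have [xv|xv] := boolP (x \in vertex_at j); last first.
    by rewrite edge_val_out // conjC0 mul0r mul0rn big1 // => i _; rewrite mul0rn.
  (* Extending a path by any [x] in its range gives a path with the same source, so the basis needs
     no truncation and exactly one index contributes. *)
  have [|i0 i0E] := @path_atP (rcons (path_at j) x).
    by rewrite -cats1 ok_cat path_at_ok /= xv.
  rewrite (bigD1 i0) //= big1 ?addr0 => [|i ii0].
    by rewrite i0E eqxx eqseq_rcons (inj_eq path_at_inj).
  by rewrite -i0E (inj_eq path_at_inj) (negPf ii0) mulr0n.
- apply/matrixP => i j; rewrite !mxE (bigD1 i) //= big1 ?addr0; last first.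
    by move=> k /negPf ki; rewrite !mxE eq_sym ki mulr0n mul0r.
  rewrite !mxE eqxx mulr1n mulr_sumr; apply: eq_bigr => x _.
  rewrite edge_val_pi_r mulrnAr; case: eqP => [e|]; last by rewrite !mulr0n.
  by rewrite /vertex_at e rng_rcons.
Qed.

Lemma model_t0_source : model_t0 (vdelta w0) <> 0.
Proof.
have [i iE] : exists i, path_at i = [::] by exact: path_atP.
move=> /matrixP/(_ i i)/eqP; rewrite !mxE eqxx mulr1n /vertex_at iE /vdelta /= eqxx.
by rewrite oner_eq0.
Qed.

End PathModel.

(** * Triviality of the Cuntz-Krieger condition *)

Section NoRegularVertices.
Context (X : choiceType).
Hypothesis fresh : forall B : {fset X}, exists x, x \notin B.

Lemma finsetGraph_E0fin : @E0fin (finsetGraph X) = set0.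
Proof.
apply/seteqP; split=> // v [V [/nbhs_singleton Vv /discrete_compactP]].
move/finite_fsetP => [B BE].
have [x xB] := fresh (v `|` [fset (val (e : finsetEdge X)).1
  | e in (B : {fset finsetEdge X})])%fset.
move: xB; rewrite in_fsetU negb_or => /andP[xv /negP]; apply.
have xw : (x, x |` v)%fset.1 \in (x, x |` v)%fset.2 by exact: fset1U1.
pose e : finsetEdge X := exist _ (x, x |` v)%fset xw.
have eB : e \in (B : {fset finsetEdge X}).
  have : (@grng (finsetGraph X) @^-1` V) e by rewrite /preimage /= fsetU1K.
  by rewrite BE.
by apply/imfsetP; exists e.
Qed.

Lemma finsetGraph_C0rg (R : realType) (f : vertex (finsetGraph X) -> R[i]) :
  C0rg (finsetGraph X) f -> f = fun=> 0.
Proof.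
case=> _ h; apply/funext => v; apply: h.
by rewrite /E0rg finsetGraph_E0fin set0D.
Qed.

(** Only [f = 0] is to be tested, so the condition reads [Phi 0 = 0]. Linearity of [Phi] is
    available on compact operators, whence the check that the zero operator is one. *)
Lemma finsetGraph_cuntz_krieger (R : realType) (A : cstarAlgebra R)
    (t0 : (vertex (finsetGraph X) -> R[i]) -> A)
    (t1 : (edge (finsetGraph X) -> R[i]) -> A) :
  toeplitz_pair t0 t1 -> cuntz_krieger_pair t0 t1.
Proof.
move=> T; split=> // Phi PhiP f /finsetGraph_C0rg ->.
rewrite (pair_t0_0 T); set k := pi_r _.
have k0 (xi : edge (finsetGraph X) -> R[i]) : k xi = fun=> 0.
  by apply/funext => e; rewrite /k /pi_r mul0r.
have inner0 xi v : inner (fun _ : edge (finsetGraph X) => 0 : R[i]) xi v = 0.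
  rewrite innerE big_seq big1 // => x xv.
  by rewrite (edge_val_in (fun=> 0) xv) conjC0 mul0r.
have kc : compact_operators (finsetGraph X) k.
  split.
    exists k; split=> [xi _|xi _|xi eta _ _]; rewrite ?k0; try exact: Cd_0.
    apply/funext => v; rewrite inner0 innerE big_seq big1 // => x xv.
    by rewrite (edge_val_in (fun=> 0) xv) mulr0.
  move=> eps eps0; exists 0%N, (fun _ _ => 0), (fun _ _ => 0); split; first by case.
  move=> zeta _ _ v.
  rewrite (_ : (fun e => _) = fun=> 0); last first.
    by apply/funext => e; rewrite big_ord0 subr0 k0.
  by rewrite inner0 exprn_ge0 // ltW.
have := Phi_linear PhiP (-1) kc kc; rewrite scaleN1r addNr => <-.
congr Phi; apply/funext => xi; apply/funext => e.
by rewrite k0 mulr0 addr0.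
Qed.

End NoRegularVertices.

Theorem proposition13p4 (R : realType) (X : choiceType)
    (X_uncountable : ~ countable [set: X])
    (A : cstarAlgebra R)
    (t0 : (vertex (finsetGraph X) -> R[i]) -> A)
    (t1 : (edge (finsetGraph X) -> R[i]) -> A)
    (A_is_OE : graph_cstar_algebra t0 t1) :
  prime_cstar A /\ ~ primitive_cstar A.
Proof.
have fresh (B : {fset X}) : exists x, x \notin B.
  apply: contrapT => h; apply: X_uncountable.
  apply: (@sub_countable _ _ _ [set` B]); last first.
    by apply: finite_set_countable; exact: finite_fset.
  by apply: subset_card_le => x _; apply: contrapT => /negP xB; apply: h; exists x.
have [[T _] gen univ] := A_is_OE.
have F := pair_family T; have dense := pair_dense T gen.
have p_neq0 (v : {fset X}) : t0 (vdelta v) <> 0.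
  (* Universality maps [t0 (vdelta v)] to its matrix in the path model with source [v], where the
     empty path witnesses that it is nonzero. *)
  have [rho [[rhoL _ _] rho0 _]] :=
    univ _ _ _ (finsetGraph_cuntz_krieger fresh (model_toeplitz R v)).
  move=> tv; apply: (@model_t0_source R X v).
  rewrite -rho0; last exact: C0_vdelta.
  have := rhoL (-1) 0 0; rewrite tv scaler0 addr0 scaleN1r => e.
  by rewrite e addNr.
split; first exact: (finset_family_prime F p_neq0 fresh dense).
case=> H [pi [rpi fpi irr]]; apply: X_uncountable.
exact: (faithful_irreducible_countable F p_neq0 dense rpi fpi irr).
Qed.
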